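(* Suppose $0<\sigma<\infty$ is known. For any $M_n\ge1$, $n\ge1$, the estimator $\hat f^{MLS}$ simultaneously has the following properties. (i) For any $0<q\le1$, $t_n>0$, $$E(ASE(\hat f^{MLS}))\le d_n^2(f_0;\mathcal{F}_q(t_n;M_n))+B_1\begin{cases}\frac{\sigma^2r_{M_n}}{n}&\text{if }m_*=M_n\wedge n,\\ \sigma^{2-q}t_n^q\Bigl(\frac{1+\log\frac{M_n}{(nt_n^2\tau)^{q/2}}}{n}\Bigr)^{1-q/2}\wedge\frac{\sigma^2r_{M_n}}{n}&\text{if }1<m_*<M_n\wedge n,\end{cases}$$ and, if $m_*=1$, $$E(ASE(\hat f^{MLS}))\le\Bigl(d_n^2(f_0;\mathcal{F}_q(t_n;M_n))+\frac{B_1(\sigma^2(1+\log M_n)\wedge\sigma^2r_{M_n})}{n}\Bigr)\wedge\Bigl(\|\bar f_{J_0}-f_0^n\|_n^2+\frac{\widetilde B_1\sigma^2}{n}\Bigr).$$ (ii) For $1\le k_n\le M_n$, $$E(ASE(\hat f^{MLS}))\le d_n^2(f_0;\mathcal{F}_0(k_n;M_n))+B_2\Bigl(\frac{\sigma^2k_n(1+\log\frac{M_n}{k_n})}{n}\wedge\frac{\sigma^2r_{M_n}}{n}\Bigr).$$ (iii) For any $0<q\le1$, $t_n>0$, and $1\le k_n\le M_n$, $$E(ASE(\hat f^{MLS}))\le d_n^2(f_0;\mathcal{F}_q(t_n;M_n)\cap\mathcal{F}_0(k_n;M_n))+B_3\begin{cases}\frac{\sigma^2k_n(1+\log\frac{M_n}{k_n})}{n}\wedge\frac{\sigma^2r_{M_n}}{n}&\text{if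 }m_*>k_n,\\ \sigma^{2-q}t_n^q\Bigl(\frac{1+\log\frac{M_n}{(nt_n^2\tau)^{q/2}}}{n}\Bigr)^{1-q/2}\wedge\frac{\sigma^2r_{M_n}}{n}&\text{if }1<m_*\le k_n,\end{cases}$$ and, if $m_*=1$, $$E(ASE(\hat f^{MLS}))\le\Bigl(d_n^2(f_0;\mathcal{F}_q(t_n;M_n)\cap\mathcal{F}_0(k_n;M_n))+\frac{B_3(\sigma^2(1+\log M_n)\wedge\sigma^2r_{M_n})}{n}\Bigr)\wedge\Bigl(\|\bar f_{J_0}-f_0^n\|_n^2+\frac{\widetilde B_3\sigma^2}{n}\Bigr).$$ (iv) For every $f_0$, $E(ASE(\hat f^{MLS}))\le B_4\sigma^2$. For these cases, the constants $\widetilde B_1$, $B_2$, $\widetilde B_3$ and $B_4$ are pure constants, and $B_1$ and $B_3$ depend on $q$.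
   Context: FIXED DESIGN. $Y_i=f_0(\mathbf{x}_i)+\varepsilon_i$, $i=1,\ldots,n$, with fixed $\mathbf{x}_i=(x_{i,1},\ldots,x_{i,M_n})'\in\mathbb{R}^{M_n}$, $\varepsilon_i$ i.i.d. $N(0,\sigma^2)$, and $\max_{1\le j\le M_n}\sum_{i=1}^nx_{i,j}^2/n\le1$. $f_0^n=(f_0(\mathbf{x}_1),\ldots,f_0(\mathbf{x}_n))'$; $\|f\|_n^2=\frac1n\sum_if^2(\mathbf{x}_i)$ (also for vectors in $\mathbb{R}^n$); $ASE(\hat f)=\|\hat f-f_0\|_n^2$; $d_n^2(f_0;\mathcal{F})=\inf_{f\in\mathcal{F}}\|f-f_0\|_n^2$. The function $f_0$ need not belong to the classes below. $f_\theta(\mathbf{x})=\sum_j\theta_jx_j$, $\|\theta\|_0$ is the number of nonzero components, $\|\theta\|_q=(\sum_j|\theta_j|^q)^{1/q}$; $\mathcal{F}_q(t_n;M_n)=\{f_\theta:\|\theta\|_q\le t_n\}$, $\mathcal{F}_0(k_n;M_n)=\{f_\theta:\|\theta\|_0\le k_n\}$. MODELS. A model $J_m\subset\{1,\ldots,M_n\}$ has size $m$; $r_J$ is the rank of the design matrix of $J$; $\hat Y_J$ is the projection of $Y=(Y_1,\ldots,Y_n)'$ onto its column span and $\bar f_J$ that of $f_0^n$. $J_{M_n}$ is the full model with rank $r_{M_n}\ge1$; $J_0$ is the null model containing only the intercept (rank 1); $\bar J$ is the full projection model with projection matrix $I_{n\times n}$ (rank $n$). $\Gamma_n$ consists of all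 $J_m$ with $1\le m\le(M_n-1)\wedge n$, together with $J_{M_n}$, $J_0$ and $\bar J$. ESTIMATOR (Leung–Barron mixing). $\hat f^{MLS}=\sum_{J\in\Gamma_n}w_J\hat Y_J$, $w_J=\frac{\pi_J\exp\{-\widehat R_J/(4\sigma^2)\}}{\sum_{J'\in\Gamma_n}\pi_{J'}\exp\{-\widehat R_{J'}/(4\sigma^2)\}}$, $\widehat R_J=n\|Y-\hat Y_J\|_n^2+2r_J\sigma^2-n\sigma^2$, with $\pi_{J_m}=0.85\bigl(((M_n-1)\wedge n)\binom{M_n}{m}\bigr)^{-1}$ for $1\le m\le(M_n-1)\wedge n$ and $\pi_{J_{M_n}}=\pi_{J_0}=\pi_{\bar J}=0.05$. $\tau=\sigma^{-2}$; $m^*=\lceil(nt_n^2\tau)^{q/2}\rceil\wedge M_n\wedge n$; $m_*=m^*$ if $m^*=M_n\wedge n$, otherwise $m_*=\lceil m^*/(1+\log(M_n/m^* ))^{q/2}\rceil$.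
   Formalization: In (iii), case 1<m_*≤k_n, log(M_n/(n t_n^2 τ)^{q/2}) is replaced by its maximum with 0, since when (n t_n^2 τ)^{q/2} reaches e·M_n (possible if m_*=M_n∧n) the printed bound vanishes or is undefined, while the risk is positive. *)

(* Defs.v *)
(* MathComp / MathComp-Analysis *)
From HB Require Import structures.
From mathcomp Require Import all_boot all_order all_algebra.
From mathcomp Require Import all_classical all_reals all_analysis.

Set Implicit Arguments.
Unset Strict Implicit.
Unset Printing Implicit Defensive.

Import Order.TTheory GRing.Theory Num.Theory.
Import numFieldNormedType.Exports.

Local Open Scope classical_set_scope.
Local Open Scope ring_scope.

(* Conventions: the design is X : 'M_(n, M), with x_i = row i X; vectors of   *)
(* R^n (responses, fitted values) are row vectors; regression functions are   *)
(* functions 'rV_M -> R, seen in R^n through their values at the x_i.         *)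

Section Norms.
Variables (R : realType) (n M : nat).

Definition normn2 (v : 'rV[R]_n) : R := (\sum_(i < n) v 0 i ^+ 2) / n%:R.

Definition at_design (X : 'M[R]_(n, M)) (f : 'rV[R]_M -> R) : 'rV[R]_n :=
  \row_(i < n) f (row i X).

Definition normalized_design (X : 'M[R]_(n, M)) : Prop :=
  forall j : 'I_M, (\sum_(i < n) X i j ^+ 2) / n%:R <= 1.

Definition ASE (X : 'M[R]_(n, M)) (f0 : 'rV[R]_M -> R) (fhat : 'rV[R]_n) : R :=
  normn2 (fhat - at_design X f0).

Definition dn2 (X : 'M[R]_(n, M)) (f0 : 'rV[R]_M -> R)
    (F : set ('rV[R]_M -> R)) : R :=
  inf [set normn2 (at_design X f - at_design X f0) | f in F].

End Norms.

Section Classes.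
Variables (R : realType) (M : nat).

Definition flin (theta : 'rV[R]_M) : 'rV[R]_M -> R :=
  fun x => \sum_(j < M) theta 0 j * x 0 j.

Definition norm0 (theta : 'rV[R]_M) : nat := #|[pred j | theta 0 j != 0]|.

(* Used for q > 0 only, where 0 `^ q = 0. *)
Definition normq (q : R) (theta : 'rV[R]_M) : R :=
  (\sum_(j < M) `|theta 0 j| `^ q) `^ q^-1.

Definition Fq (q t : R) : set ('rV[R]_M -> R) :=
  [set flin theta | theta in [set theta | normq q theta <= t]].

Definition F0 (k : nat) : set ('rV[R]_M -> R) :=
  [set flin theta | theta in [set theta | (norm0 theta <= k)%N]].

End Classes.

(* Orthogonal projection of R^n onto the column span of A, acting on row      *)
(* vectors as v *m colproj A: projection onto the row space of A^T along      *)
(* kermx A = {u | u *m A = 0}, the orthogonal complement of that span.        *)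
Definition colproj (R : realType) (n p : nat) (A : 'M[R]_(n, p)) : 'M[R]_n :=
  proj_mx <<A^T>>%MS (kermx A).

(* SubModel J is the model J_m with m = #|J|.  Models are labels: distinct    *)
(* models stay distinct in Gamma even when their column spans coincide.       *)
Inductive model (M : nat) : Type :=
  | SubModel of {set 'I_M}
  | FullModel
  | NullModel
  | ProjModel.
Arguments FullModel {M}.
Arguments NullModel {M}.
Arguments ProjModel {M}.

Section Mixing.
Variables (R : realType) (n M : nat).

Definition Gamma : seq (model M) :=
  [:: FullModel; NullModel; ProjModel]
  ++ [seq SubModel J | J <- enum [pred U : {set 'I_M} |
                                    (1 <= #|U| <= minn (M - 1) n)%N]].

Definition model_width (J : model M) : nat :=
  match J with
  | SubModel U => #|U|
  | FullModel => M
  | NullModel => 1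
  | ProjModel => n
  end.

Definition model_design (X : 'M[R]_(n, M)) (J : model M) :
    'M[R]_(n, model_width J) :=
  match J with
  | SubModel U => colsub (fun k : 'I_#|U| => enum_val k) X
  | FullModel => X
  | NullModel => const_mx 1
  | ProjModel => 1%:M
  end.

Definition model_rank (X : 'M[R]_(n, M)) (J : model M) : nat :=
  \rank (model_design X J).

Definition model_fit (X : 'M[R]_(n, M)) (J : model M) (y : 'rV[R]_n) :
    'rV[R]_n :=
  y *m colproj (model_design X J).

Definition prior (J : model M) : R :=
  match J with
  | SubModel U => 85%:R / 100%:R / ((minn (M - 1) n)%:R * 'C(M, #|U|)%:R)
  | _ => 5%:R / 100%:R
  end.

Definition risk_estimate (sigma : R) (X : 'M[R]_(n, M)) (Y : 'rV[R]_n)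
    (J : model M) : R :=
  n%:R * normn2 (Y - model_fit X J Y)
  + 2 * (model_rank X J)%:R * sigma ^+ 2 - n%:R * sigma ^+ 2.

Definition raw_weight (sigma : R) (X : 'M[R]_(n, M)) (Y : 'rV[R]_n)
    (J : model M) : R :=
  prior J * expR (- risk_estimate sigma X Y J / (4 * sigma ^+ 2)).

Definition weight (sigma : R) (X : 'M[R]_(n, M)) (Y : 'rV[R]_n)
    (J : model M) : R :=
  raw_weight sigma X Y J / \sum_(J' <- Gamma) raw_weight sigma X Y J'.

Definition fMLS (sigma : R) (X : 'M[R]_(n, M)) (Y : 'rV[R]_n) : 'rV[R]_n :=
  \sum_(J <- Gamma) weight sigma X Y J *: model_fit X J Y.

End Mixing.

Section EffectiveSize.
Variables (R : realType) (n M : nat) (sigma q t : R).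

Definition tau : R := sigma ^- 2.

Definition snr : R := (n%:R * t ^+ 2 * tau) `^ (q / 2).

Definition m_upper : nat := minn `|Num.ceil snr|%N (minn M n).

Definition m_lower : nat :=
  if m_upper == minn M n then m_upper
  else `|Num.ceil (m_upper%:R / (1 + ln (M%:R / m_upper%:R)) `^ (q / 2))|%N.

Definition lq_rate (logterm : R) : R :=
  sigma `^ (2 - q) * t `^ q * ((1 + logterm) / n%:R) `^ (1 - q / 2).

End EffectiveSize.

Section Noise.
Context d (T : measurableType d) (R : realType) (P : probability T R).
Variables (n : nat) (eps : 'I_n -> {RV P >-> R}).

Definition mutually_independent : Prop :=
  forall (I : {set 'I_n}) (A : 'I_n -> set R),
    (forall i, measurable (A i)) ->
    P [set w | forall i, i \in I -> A i (eps i w)]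
    = (\prod_(i in I) P (eps i @^-1` A i))%E.

(* The second parameter of normal_prob is the standard deviation. *)
Definition iid_normal (sigma : R) : Prop :=
  mutually_independent /\
  forall (i : 'I_n) (A : set R), measurable A ->
    distribution P (eps i) A = normal_prob 0 sigma A.

Definition response M (X : 'M[R]_(n, M)) (f0 : 'rV[R]_M -> R) (w : T) :
    'rV[R]_n :=
  at_design X f0 + \row_(i < n) eps i w.

Definition risk_MLS M (sigma : R) (X : 'M[R]_(n, M)) (f0 : 'rV[R]_M -> R) :
    \bar R :=
  'E_P[fun w => ASE X f0 (fMLS sigma X (response X f0 w))]%E.

End Noise.

(* Main.v *)
Require Import Defs.
From HB Require Import structures.
From mathcomp Require Import all_boot all_order all_algebra.
From mathcomp Require Import all_classical all_reals all_analysis.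
From mathcomp Require Import measurable_realfun lebesgue_measure.
From mathcomp Require Import ring lra.

(** Why the theorem holds.  Write f for the values of [f0] at the design points,
Y for f plus the noise, and [Q i] for the orthogonal projection of the i-th
model.

Each projection comes with an unbiased estimate of its risk, its residual sum
of squares corrected by its rank ([penalized_rss]).  The temperature of the
mixing weights, four times the variance, is the one at which the unbiased risk
estimate of the mixture is exactly the weighted average of these estimates
([sum_penalized_rss]): differentiating the weights produces the weighted
variance of the fits, which is what the squared residual of the average fit
lacks compared with the average of the squared residuals.  Gibbs weights
minimise mean energy plus relative entropy to the prior, so this average is at
most the estimate for any one model plus 4 sigma^2 ln (1 / prior)
([gibbs_variational]).  Expectations then give [oracle_inequality]: the mixture
costs no more than any model J, whose price is its squared bias plus sigma^2
times its rank plus 4 sigma^2 ln (1 / prior J).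

The expectations rest on Gaussian integration by parts.  On the line it is the
fundamental theorem of calculus for g times the density ([integral_stein]).  By
independence a coordinate of the noise and the other coordinates have a product
law ([integral_iid_coord0]), and Fubini carries the formula to functions of the
whole vector ([centered_stein]).  The pointwise inequality behind the oracle
inequality holds up to terms that this formula integrates to zero.

What remains is to choose a model for each class.  The full, null and
projection models have a fixed prior mass, hence the bounds by the rank, by the
error of the null model and by sigma^2.  A model of size k costs a constant
times sigma^2 k (1 + ln (M / k)) ([risk_sparse_le]), which settles the k-sparse
class.  In an lq ball, few coefficients exceed a given threshold and the others
have a small l1 norm; the former are kept and the combination of the latter is
replaced by the average of b columns drawn with probabilities proportional to
the coefficients.  This average has the right mean, so in expectation it adds
to the squared error only its variance, of order 1 / b, and some draw does at
least as well ([sparse_approx]).  Because the error of the original combination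
enters with the factor one, the infimum over the class can be taken.
[m_lower] is the number of columns that balances this variance with the price
of the model ([maurey_rate], [sparsity_price_m_lower]).  When it is 1 a single
drawn column is enough ([one_term_rate]); when it is as large as the rank can
be, the full model is. *)

Set Implicit Arguments.
Unset Strict Implicit.
Unset Printing Implicit Defensive.

Import Order.TTheory GRing.Theory Num.Theory.
Import numFieldNormedType.Exports.

Local Open Scope classical_set_scope.
Local Open Scope ring_scope.

(** * Gaussian integration by parts on the line *)

Section NormalIntegral.
Context {R : realType}.
Implicit Types (s : R) (f : R -> R).
Local Notation mu := (@lebesgue_measure R).

Lemma ge0_integral_normal_prob (m s : R) (f : measurableTypeR R -> \bar R) :
  measurable_fun setT f -> (forall x, 0 <= f x)%E ->
  (\int[normal_prob m s]_x f x = \int[mu]_x (f x * (normal_pdf m s x)%:E))%E.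
Proof.
move=> mf f0.
have dom : normal_prob m s `<< mu by exact: normal_prob_dominates.
rewrite -(Radon_Nikodym_SigmaFinite.change_of_variables dom f0)//.
apply: ae_eq_integral => //.
- apply: emeasurable_funM => //.
  exact: measurable_int (Radon_Nikodym_SigmaFinite.f_integrable dom).
- apply: emeasurable_funM => //.
  apply/measurable_EFinP. apply: measurable_normal_pdf.
- apply: ae_eqe_mul2l => /=. apply: integral_ae_eq => //=.
  + exact: Radon_Nikodym_SigmaFinite.f_integrable.
  + by apply/measurable_EFinP; exact: measurable_normal_pdf.
  + by move=> E _ mE; rewrite -Radon_Nikodym_SigmaFinite.f_integral.
Qed.

Lemma integral_normal_prob (m s : R) (f : measurableTypeR R -> \bar R) :
  (normal_prob m s).-integrable setT f ->
  (\int[normal_prob m s]_x f x = \int[mu]_x (f x * (normal_pdf m s x)%:E))%E.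
Proof.
move=> intf; have mf := measurable_int _ intf.
rewrite [LHS]integralE [RHS]integralE !ge0_integral_normal_prob//; last 2 first.
  exact: measurable_funeneg.
  exact: measurable_funepos.
congr (_ - _)%E; apply: eq_integral => x _.
- by rewrite !funeposE maxe_pMl ?mul0e ?lee_fin ?normal_pdf_ge0.
- by rewrite !funenegE maxe_pMl ?mul0e ?lee_fin ?normal_pdf_ge0// mulNe.
Qed.

(** Polynomial factors are absorbed by doubling the standard deviation: up to a
constant, a density with larger variance serves as the integrable majorant of
every integrand below, and as the decay at infinity. *)
Lemma normal_pdf_sq_le (s : R) : 0 < s -> exists2 K : R, 0 <= K &
  forall x, (1 + x ^+ 2) * normal_pdf 0 s x <= K * normal_pdf 0 (2 * s) x.
Proof.
move=> s0; have s20 : 0 < 2 * s by rewrite mulr_gt0.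
have sn0 : s != 0 by rewrite gt_eqF.
have s2n0 : 2 * s != 0 by rewrite gt_eqF.
have p0 := @normal_peak_gt0 R _ sn0; have p20 := @normal_peak_gt0 R _ s2n0.
(* The quotient of the two exponentials is exp u with u = 3 x^2 / (8 s^2), and
   exp u >= 1 + u. *)
exists ((1 + 8 * s ^+ 2) * (normal_peak s / normal_peak (2 * s))).
  by apply: mulr_ge0; [rewrite addr_ge0// mulr_ge0// sqr_ge0|rewrite divr_ge0 ?ltW].
move=> x; rewrite !normal_pdfE// /normal_fun !subr0.
set e1 := expR _; set e2 := expR _.
have -> : (1 + 8 * s ^+ 2) * (normal_peak s / normal_peak (2 * s)) *
          (normal_peak (2 * s) * e2) = normal_peak s * ((1 + 8 * s ^+ 2) * e2).
  by field; rewrite gt_eqF.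
rewrite mulrCA ler_pM2l//.
pose u := 3 * x ^+ 2 / (8 * s ^+ 2).
have -> : e2 = e1 * expR u.
  by rewrite -expRD; congr expR; rewrite /u; field.
rewrite mulrA [_ * e1]mulrC -mulrA [leRHS]mulrA [_ * e1]mulrC -mulrA.
rewrite ler_pM2l ?expR_gt0//.
apply: (@le_trans _ _ ((1 + 8 * s ^+ 2) * (1 + u))); last first.
  by rewrite ler_wpM2l ?expR_ge1Dx// addr_ge0// mulr_ge0// sqr_ge0.
have -> : (1 + 8 * s ^+ 2) * (1 + u) = 1 + 8 * s ^+ 2 + u + 3 * x ^+ 2.
  by rewrite /u; field.
have : 0 <= u by rewrite divr_ge0// mulr_ge0// sqr_ge0.
have := sqr_ge0 x; have := sqr_ge0 s; lra.
Qed.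

Lemma integrable_normal_prob_le (s K : R) (f : measurableTypeR R -> R) : 0 < s ->
  measurable_fun setT f ->
  (forall x, `|f x| <= K * (1 + x ^+ 2)) ->
  (normal_prob 0%R s).-integrable setT (EFin \o f).
Proof.
move=> s0 mf fK; have K0 : 0 <= K.
  by have := fK 0; rewrite expr0n/= addr0 mulr1; exact: le_trans.
have [L L0 HL] := normal_pdf_sq_le s0.
apply/integrableP; split; first by apply/measurable_EFinP.
rewrite ge0_integral_normal_prob//; last first.
  by apply: measurableT_comp => //; apply/measurable_EFinP.
apply: (@le_lt_trans _ _ (\int[mu]_x ((K * L)%:E * (normal_pdf 0 (2 * s) x)%:E))%E).
  apply: ge0_le_integral => //.
  - by move=> x _; rewrite mule_ge0 ?lee_fin ?normal_pdf_ge0.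
  - apply: emeasurable_funM; last by apply/measurable_EFinP; exact: measurable_normal_pdf.
    by apply: measurableT_comp => //; apply/measurable_EFinP.
  - by apply: emeasurable_funM => //; apply/measurable_EFinP; exact: measurable_normal_pdf.
  - move=> x _; rewrite /= -!EFinM lee_fin -mulrA.
    apply: le_trans (ler_wpM2l K0 (HL x)).
    by rewrite mulrA ler_wpM2r ?normal_pdf_ge0.
rewrite integralZl//; last exact: integrable_normal_pdf.
by rewrite integral_normal_pdf mule1 ltry.
Qed.

Lemma is_derive_normal_pdf (s x : R) : 0 < s ->
  is_derive x 1 (normal_pdf 0 s) (- (x / s ^+ 2) * normal_pdf 0 s x).
Proof.
move=> s0; have sn0 : s != 0 by rewrite gt_eqF.
rewrite normal_pdfE// /normal_fun.
apply: is_derive_eq.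
rewrite /GRing.scale /=; field; exact: sn0.
Qed.

(** The integrand times the density is the derivative of - s^2 g times the
density.  Its integral over a centered interval is a boundary term, which
vanishes as the interval grows. *)
Lemma integral_stein (s C : R) (g g' : R -> R) : 0 < s ->
  (forall x : R, is_derive x 1 g (g' x)) -> continuous g' ->
  (forall x, g x ^+ 2 <= C * (1 + x ^+ 2)) ->
  (forall x, `|g' x| <= C * (1 + x ^+ 2)) ->
  (\int[normal_prob 0%R s]_x (x * g x - s ^+ 2 * g' x)%:E = 0)%E.
Proof.
move=> s0 dg cg' gC g'C.
have sn0 : s != 0 by rewrite gt_eqF.
have cg : continuous g.
  by move=> x; apply/differentiable_continuous/derivable1_diffP; have [] := dg x.
have C0 : 0 <= C by have := g'C 0; rewrite expr0n/= addr0 mulr1; exact: le_trans.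
pose h (x : R) : R := x * g x - s ^+ 2 * g' x.
have ch : continuous h.
  by move=> x; apply: cvgB; apply: cvgM; [exact: cvg_id|exact: cg|exact: cvg_cst|exact: cg'].
have mh : measurable_fun setT h by exact: continuous_measurable_fun.
pose K := 1 + C + s ^+ 2 * C.
have hK x : `|h x| <= K * (1 + x ^+ 2).
  have xg : `|x * g x| <= (1 + C) * (1 + x ^+ 2).
    have := gC x; have := sqr_ge0 x; rewrite normrM -[x ^+ 2]real_normK ?num_real//.
    rewrite -[g x ^+ 2]real_normK ?num_real//.
    have := sqr_ge0 (`|x| - `|g x|); have := normr_ge0 x; have := normr_ge0 (g x).
    nra.
  apply: (le_trans (ler_normB _ _)).
  rewrite /K [leRHS]mulrDl lerD// normrM ger0_norm ?sqr_ge0// -mulrA.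
  by rewrite ler_wpM2l ?sqr_ge0.
rewrite integral_normal_prob; last exact: (@integrable_normal_prob_le s K h).
pose k (x : R) : R := h x * normal_pdf 0 s x.
pose G (x : R) : R := - s ^+ 2 * (g x * normal_pdf 0 s x).
have dG (x : R) : is_derive x 1 G (k x).
  have := is_derive_normal_pdf x s0; have := dg x => d1 d2.
  apply: is_derive_eq.
  by rewrite /GRing.scale /= /k /h; field.
have cG : continuous G.
  by move=> x; apply/differentiable_continuous/derivable1_diffP; have [] := dG x.
have ck : continuous k.
  by move=> x; apply: continuousM; [exact: ch|exact: continuous_normal_pdf].
have mk : measurable_fun setT (EFin \o k).
  by apply/measurable_EFinP; exact: continuous_measurable_fun.
have [L L0 HL] := normal_pdf_sq_le s0.
pose b (x : R) := (K * L * normal_pdf 0 (2 * s) x)%:E.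
have kb x : `|k x| <= K * L * normal_pdf 0 (2 * s) x.
  rewrite normrM (ger0_norm (normal_pdf_ge0 _ _ _)).
  apply: le_trans (ler_wpM2r (normal_pdf_ge0 _ _ _) (hK x)) _.
  rewrite -!mulrA; apply: ler_wpM2l (HL x).
  by rewrite !addr_ge0// mulr_ge0// sqr_ge0.
have ib : mu.-integrable setT b.
  rewrite /b; under eq_fun do rewrite EFinM.
  by apply: integrableZl => //; exact: integrable_normal_pdf.
pose D n := `[- n.+1%:R, n.+1%:R]%classic : set R.
pose f_ n := ((EFin \o k) \_ (D n))%E.
have mf_ n : measurable_fun setT (f_ n).
  have mD : measurable (D n) by exact: measurable_itv.
  by apply/(measurable_restrictT _ mD); exact: measurable_funTS.
have f_k : {ae mu, forall x, setT x -> f_ ^~ x @ \oo --> (EFin \o k) x}.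
  apply/aeW => x _; apply: cvg_near_cst.
  near=> n; rewrite /f_ patchE mem_set// /D/= in_itv/= -ler_norml.
  near: n; exists (Num.trunc `|x|) => //= n /= xn.
  by apply/ltW/(lt_le_trans (truncnS_gt _)); rewrite ler_nat.
have f_b : {ae mu, forall x n, setT x -> (`|f_ n x| <= b x)%E}.
  apply/aeW => x n _; rewrite /f_ patchE; case: ifPn => _.
    by rewrite /= lee_fin.
  by rewrite abse0 lee_fin; apply: le_trans (kb x).
have [_ _ cvgk] :=
  @dominated_convergence _ _ _ mu setT measurableT f_ (EFin \o k) b mf_ mk f_k ib f_b.
have [L2 L20 HL2] := normal_pdf_sq_le (s := 2 * s) (mulr_gt0 (ltr0n _ 2) s0).
have s4 : 2 * (2 * s) != 0 :> R by rewrite !mulf_neq0.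
pose A := s ^+ 2 * ((1 + C) * (L * (L2 * normal_peak (2 * (2 * s))))).
have A0 : 0 <= A.
  have := normal_peak_ge0 (2 * (2 * s)); have := sqr_ge0 s => s2 p.
  by rewrite /A; do !apply: mulr_ge0 => //; rewrite addr_ge0.
have GA x : `|G x| <= A / (1 + x ^+ 2).
  have x1 : 0 < 1 + x ^+ 2 by rewrite ltr_pwDl ?sqr_ge0.
  have gx : `|g x| <= (1 + C) * (1 + x ^+ 2).
    have := gC x; have := sqr_ge0 x; have := sqr_ge0 (1 - `|g x|).
    by rewrite -[g x ^+ 2]real_normK ?num_real//; nra.
  have -> : `|G x| = s ^+ 2 * (`|g x| * normal_pdf 0 s x).
    rewrite /G mulNr normrN [LHS]normrM ger0_norm ?sqr_ge0// [in LHS]normrM.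
    by rewrite (ger0_norm (normal_pdf_ge0 _ _ _)).
  rewrite ler_pdivlMr// /A -mulrA; apply: ler_wpM2l; first exact: sqr_ge0.
  apply: (@le_trans _ _ ((1 + C) * (1 + x ^+ 2) * (L * normal_pdf 0 (2 * s) x))).
    rewrite -[leLHS]mulrA; apply: ler_pM => //; first by rewrite mulr_ge0 ?normal_pdf_ge0// ltW.
    by rewrite mulrC.
  rewrite -mulrA; apply: ler_wpM2l; first by rewrite addr_ge0.
  rewrite mulrCA; apply: ler_wpM2l => //; apply: le_trans (HL2 x) _.
  by apply: ler_wpM2l => //; exact: normal_pdf_ub.
suff c0 : [sequence (\int[mu]_(x in setT) (f_ n x))%E]_n @ \oo --> 0%E.
  exact: (cvg_unique (@ereal_hausdorff R) cvgk c0).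
have -> : [sequence (\int[mu]_(x in setT) (f_ n x))%E]_n =
   (fun n => (G n.+1%:R - G (- n.+1%:R))%:E).
  apply/funext => n /=; rewrite /f_ -integral_mkcond.
  rewrite (@continuous_FTC2 _ k G)//.
  - by rewrite -[ltRHS]opprK ltrN2 (@lt_trans _ _ 0)// oppr_lt0.
  - exact: continuous_subspaceT.
  - split.
    + by move=> x _; by have [] := dG x.
    + apply: cvg_at_right_filter.
      exact: cG.
    + apply: cvg_at_left_filter.
      exact: cG.
  - by move=> x _; rewrite derive1E; apply: derive_val.
apply: cvg_EFin; first exact: nearW.
apply: norm_cvg0.
have bn : (fun n : nat => 2 * A * harmonic n) @ \oo --> (0 : R).
  by rewrite -[X in _ --> X](mulr0 (2 * A)); apply: cvgM; [exact: cvg_cst|exact: cvg_harmonic].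
apply: (squeeze_cvgr _ (cvg_cst 0) bn).
near=> n; rewrite normr_ge0 /=.
have An : A / (1 + n.+1%:R ^+ 2) <= A * harmonic n.
  have p0 : (0 : R) < 1 + n.+1%:R ^+ 2 by rewrite ltr_pwDl ?sqr_ge0.
  rewrite /harmonic /=; apply: ler_wpM2l => //; rewrite lef_pV2 ?posrE ?ltr0n//.
  have : (1 : R) <= n.+1%:R by rewrite ler1n.
  nra.
apply: (le_trans (ler_normB _ _)).
rewrite -mulrA mulr_natl mulr2n; apply: lerD; first exact: le_trans (GA _) An.
by apply: le_trans (GA _) _; rewrite sqrrN.
Unshelve. all: by end_near. Qed.
End NormalIntegral.

(** * Gaussian integration by parts for a noise vector *)

Section QuadraticGrowth.
Context {R : realType} {n : nat}.
Implicit Types (a b : 'rV[R]_n) (h : 'rV[R]_n -> R).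

Definition sqnorm a : R := \sum_k a 0 k ^+ 2.

Lemma sqnorm_ge0 a : 0 <= sqnorm a.
Proof. by apply: sumr_ge0 => k _; exact: sqr_ge0. Qed.

Lemma sqnormZ (x : R) a : sqnorm (x *: a) = x ^+ 2 * sqnorm a.
Proof. by rewrite /sqnorm mulr_sumr; apply: eq_bigr => k _; rewrite mxE exprMn. Qed.

Lemma sqnorm_delta i : sqnorm (delta_mx 0 i) = 1.
Proof.
rewrite /sqnorm (bigD1 i)//= big1 => [|k /negbTE ki]; rewrite mxE ?ki ?andbF ?expr0n//.
by rewrite !eqxx expr1n addr0.
Qed.

Lemma sqnormD_le a b : 1 + sqnorm (a + b) <= (2 + 2 * sqnorm a) * (1 + sqnorm b).
Proof.
have ab : sqnorm (a + b) <= 2 * sqnorm a + 2 * sqnorm b.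
  rewrite /sqnorm !mulr_sumr -big_split/=; apply: ler_sum => k _; rewrite mxE.
  by have := sqr_ge0 (a 0 k - b 0 k); nra.
by have := sqnorm_ge0 a; have := sqnorm_ge0 b; nra.
Qed.

(** Row vectors carry no sigma-algebra here, so measurability of h is expressed
through composition with any map whose coordinates are measurable.  The same h
is evaluated on the sample space and on a product space. *)
Definition coord_measurable h := forall d (S : measurableType d) (y : S -> 'rV[R]_n),
  (forall k, measurable_fun setT (fun s => y s 0 k)) -> measurable_fun setT (h \o y).

Definition quadratic_growth h := exists C : R, forall a, `|h a| <= C * (1 + sqnorm a).

End QuadraticGrowth.

Section GaussianStein.
Context d (T : measurableType d) (R : realType) (P : probability T R).
Variables (n : nat) (eps : 'I_n -> {RV P >-> R}).

(** Generators of the information carried by all coordinates but the i-th.  The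
sample space with this smaller sigma-algebra plays the role of the space of the
other coordinates, which avoids the law of a random vector. *)
Definition other_cylinders (i : 'I_n) : set (set T) :=
  [set B | exists A : 'I_n -> set R, (forall j, measurable (A j)) /\
     B = [set w | forall j, j != i -> A j (eps j w)]].

Lemma other_cylinders_setI i : setI_closed (other_cylinders i).
Proof.
move=> _ _ [A [mA ->]] [B [mB ->]]; exists (fun j => A j `&` B j); split.
  by move=> j; exact: measurableI.
apply/seteqP; split => w /=.
  by move=> [wA wB] j ji; split; [exact: wA|exact: wB].
by move=> wAB; split => j /wAB[].
Qed.

Lemma measurable_other_cylinders i (B : set T) :
  <<s other_cylinders i >> B -> measurable B.
Proof.
apply: smallest_sub; first exact: sigma_algebra_measurable.
move=> _ [A [mA ->]].
have -> : [set w | forall j, j != i -> A j (eps j w)] =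
   \big[setI/setT]_(j < n | j != i) (eps j @^-1` A j).
  apply/seteqP; split => w /=.
    by move=> wA; rewrite -bigcap_seq_cond => j /andP[_ ji]; exact: wA.
  by rewrite -bigcap_seq_cond => wA j ji; apply: wA; rewrite /= mem_index_enum.
apply: bigsetI_measurable => j _.
exact: measurable_funPTI.
Qed.

Lemma independent_other_cylinders i (A : set R) (B : set T) :
  mutually_independent eps -> measurable A -> <<s other_cylinders i >> B ->
  P (eps i @^-1` A `&` B) = (P (eps i @^-1` A) * P B)%E.
Proof.
move=> ind mA.
pose E := eps i @^-1` A.
have mE : measurable E.
  exact: measurable_funPTI.
apply: (@dynkin_induction _ (g_sigma_algebraType (other_cylinders i)) (other_cylinders i)
   (fun B => P (E `&` B) = (P E * P B)%E)) => //.
- exact: other_cylinders_setI.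
- by rewrite setIT probability_setT mule1.
- move=> _ [C [mC ->]].
  pose C' j := if j == i then A else C j.
  have mC' j : measurable (C' j) by rewrite /C'; case: ifP.
  have := ind [set: 'I_n]%SET C' mC'.
  have := ind (~: [set i])%SET C mC.
  under eq_bigl do rewrite finset.inE.
  rewrite [X in P X = _ -> _](_ : _ = [set w | forall j, j != i -> C j (eps j w)]); last first.
    by apply/seteqP; split => w /= wC j; have := wC j; rewrite !finset.inE.
  move=> ->.
  rewrite [X in P X = _ -> _](_ : _ =
      E `&` [set w | forall j, j != i -> C j (eps j w)]); last first.
    apply/seteqP; split => w /=.
      move=> wC; split; first by have := wC i; rewrite /C' eqxx finset.inE; exact.
      by move=> j /negbTE ji; have := wC j; rewrite /C' ji finset.inE; exact.
    by move=> [wA wC] j _; rewrite /C'; case: ifPn => [/eqP->//|]; exact: wC.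
  move=> ->; rewrite (bigD1 i) ?finset.inE//= /C' eqxx; congr (_ * _)%E.
  apply: eq_big => j; first by rewrite !finset.inE.
  by move=> /andP[_ /negbTE ->].
- move=> S /measurable_other_cylinders mS HS.
  rewrite -setDE probability_setC// muleBr ?fin_num_measure// mule1 -HS.
  rewrite measureD//; last by rewrite ltey_eq fin_num_measure.
- move=> F mF tF HF.
  have mF' k : measurable (F k : set T) by apply: (@measurable_other_cylinders i); exact: mF.
  rewrite setI_bigcupr measure_bigcup//; last 2 first.
  + by move=> k _; exact: measurableI.
  + exact: trivIset_setIl.
  have PE : P E = (fine (P E))%:E by rewrite fineK// fin_num_measure.
  rewrite PE (@eq_eseriesr R _ (fun k => ((fine (P E))%:E * P (F k))%E)); last first.
    by move=> k _; rewrite -PE; exact: HF.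
  by rewrite nneseriesZl// measure_bigcup.
Qed.

(** The pair of the i-th coordinate and the sample point, seen through the other
coordinates, has a product law, since it does on rectangles.  Fubini with the
i-th coordinate integrated first then applies. *)
Lemma integral_iid_coord0 (i : 'I_n) (s : R)
    (K : measurableTypeR R * g_sigma_algebraType (other_cylinders i) -> R) :
  iid_normal eps s -> measurable_fun setT K ->
  P.-integrable setT (fun w => (K (eps i w, w))%:E) ->
  (forall w, (\int[normal_prob 0%R s]_x (K (x, w))%:E = 0)%E) ->
  (\int[P]_w (K (eps i w, w))%:E = 0)%E.
Proof.
move=> [ind nrm] mK iK K0.
pose Ti : measurableType _ := g_sigma_algebraType (other_cylinders i).
pose rest (w : T) : Ti := w.
have mrest : measurable_fun setT rest.
  by move=> _ B mB; rewrite setTI; exact: (@measurable_other_cylinders i).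
pose rest' : {mfun T >-> Ti} :=
  MeasurableFun.Pack (MeasurableFun.Class (isMeasurableFun.Build _ _ _ _ _ mrest)).
pose phi (w : T) : measurableTypeR R * Ti := (eps i w, w).
have mphi : measurable_fun setT phi.
  exact: (measurable_fun_pair (measurable_funPT (eps i)) mrest).
pose phi' : {mfun T >-> (measurableTypeR R * Ti)%type} :=
  MeasurableFun.Pack (MeasurableFun.Class (isMeasurableFun.Build _ _ _ _ _ mphi)).
pose m1 := normal_prob 0%R s : probability (measurableTypeR R) R.
pose m2 := distribution P rest' : probability Ti R.
pose m' := distribution P phi' : probability (measurableTypeR R * Ti)%type R.
have m'E X : measurable X -> (m1 \x m2)%E X = m' X.
  apply: (@product_measure_unique _ _ _ _ _ m1 m2 m') => A B mA mB.
  rewrite /m' /m2 /distribution /pushforward /=.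
  rewrite -[X in _ = (X * _)%E](nrm i A mA).
  exact: independent_other_cylinders.
have mKE : measurable_fun setT (EFin \o K) by apply/measurable_EFinP.
have iKm' : m'.-integrable setT (EFin \o K).
  by apply: (integrable_pushforward mphi).
have iKm : (m1 \x m2)%E.-integrable setT (EFin \o K).
  move/integrableP : iKm' => [_ lty]; apply/integrableP; split => //.
  by rewrite (eq_measure_integral m')// => A mA _; exact: m'E.
transitivity (\int[m']_z (EFin \o K) z)%E.
  by rewrite /m' integral_distribution.
transitivity (\int[m1 \x m2]_z (EFin \o K) z)%E.
  by apply: eq_measure_integral => A mA _; apply/esym; exact: m'E.
rewrite -integral21_prod_meas1//; apply: integral0_eq => w _.
exact: K0.
Qed.

Definition centered (W : T -> R) :=
  P.-integrable setT (EFin \o W) /\ (\int[P]_w (W w)%:E = 0)%E.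

Let noise w : 'rV[R]_n := \row_j eps j w.

Lemma integrable_quadratic_noise (s : R) (h : 'rV[R]_n -> R) : 0 < s ->
  iid_normal eps s -> coord_measurable h -> quadratic_growth h ->
  P.-integrable setT (fun w => (h (noise w))%:E).
Proof.
move=> s0 [_ nrm] mh [C hC].
have mn k : measurable_fun setT (fun w => noise w 0 k).
  by under eq_fun do rewrite mxE; exact: measurable_funPT.
have sq k : P.-integrable setT (fun w => (eps k w ^+ 2)%:E).
  pose f (x : measurableTypeR R) : R := x ^+ 2.
  have mf : measurable_fun setT f by apply: measurable_funX.
  have := @integrable_normal_prob_le _ s 1 f s0 mf _.
  have fle x : `|f x| <= 1 * (1 + x ^+ 2).
    by rewrite mul1r ger0_norm ?sqr_ge0// /f lerDr.
  move=> /(_ fle)/integrableP[mf' fin]; apply/integrableP; split.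
    by apply/measurable_EFinP; apply: measurable_funX; exact: measurable_funPT.
  pose ek (w : T) : measurableTypeR R := eps k w.
  have mek : measurable_fun setT ek by exact: (measurable_funPT (eps k)).
  pose ek' : {mfun T >-> measurableTypeR R} :=
    MeasurableFun.Pack (MeasurableFun.Class (isMeasurableFun.Build _ _ _ _ _ mek)).
  have -> : (\int[P]_w `|(eps k w ^+ 2)%:E| = \int[distribution P ek']_x `|(f x)%:E|)%E.
    by rewrite ge0_integral_distribution//; apply: measurableT_comp.
  rewrite (eq_measure_integral (normal_prob 0%R s))// => A mA _.
  exact: nrm.
apply: (@le_integrable _ _ _ P setT measurableT _ (fun w => (C * (1 + \sum_k eps k w ^+ 2))%:E)).
- by apply/measurable_EFinP; exact: mh.
- move=> w _ /=; rewrite lee_fin; apply: (le_trans (hC _)); apply: le_trans (ler_norm _).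
  rewrite le_eqVlt; apply/orP; left; apply/eqP; congr (_ * (_ + _)).
  by apply: eq_bigr => k _; rewrite mxE.
under eq_fun do rewrite EFinM EFinD -sumEFin.
apply: integrableZl => //; apply: integrableD => //.
  exact: finite_measure_integrable_cst.
by apply: integrable_sum => // k _.
Qed.

(** Stein's identity in one coordinate.  Quadratic growth is all that the second
moments of the noise can integrate, and all that the mixture requires. *)
Lemma centered_stein (s : R) (i : 'I_n) (f : 'rV[R]_n) (h h' : 'rV[R]_n -> R) :
  0 < s -> iid_normal eps s -> coord_measurable h -> coord_measurable h' ->
  (forall y (x : R), is_derive x 1 (fun u : R => h (y + u *: delta_mx 0 i))
                       (h' (y + x *: delta_mx 0 i))) ->
  (forall y, continuous (fun x : R => h' (y + x *: delta_mx 0 i))) ->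
  quadratic_growth (fun y => h y ^+ 2) -> quadratic_growth h' ->
  centered (fun w => eps i w * h (f + noise w) - s ^+ 2 * h' (f + noise w)).
Proof.
move=> s0 nrm mh mh' dh ch [C1 hC1] [C2 hC2].
pose C := Num.max C1 C2.
have hC a : h a ^+ 2 <= C * (1 + sqnorm a).
  apply: le_trans (ler_norm _) _; apply: le_trans (hC1 a) _.
  by rewrite ler_wpM2r ?addr_ge0 ?sqnorm_ge0// /C le_max lexx.
have h'C a : `|h' a| <= C * (1 + sqnorm a).
  apply: le_trans (hC2 a) _.
  by rewrite ler_wpM2r ?addr_ge0 ?sqnorm_ge0// /C le_max lexx orbT.
have C0 : 0 <= C.
  have := h'C 0; rewrite /sqnorm big1 ?addr0 ?mulr1; first exact: le_trans.
  by move=> k _; rewrite mxE expr0n.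
(* The i-th coordinate of the noise becomes a free variable; the others are
   read off the sample point. *)
pose base w : 'rV[R]_n := \row_j (f 0 j + (if j == i then 0 else eps j w)).
pose S : measurableType _ :=
  (measurableTypeR R * g_sigma_algebraType (other_cylinders i))%type.
pose y (z : S) := base z.2 + (z.1 : R) *: delta_mx 0 i.
have yE w : y (eps i w, w) = f + noise w.
  apply/rowP => j; rewrite !mxE /=; have [->|ji] := eqVneq j i.
    by rewrite addr0 mulr1.
  by rewrite mulr0 addr0.
pose K (z : S) := (z.1 : R) * h (y z) - s ^+ 2 * h' (y z).
have mfst : measurable_fun setT (fun z : S => z.1 : R) by exact: measurable_fst.
have my k : measurable_fun setT (fun z : S => y z 0 k).
  have -> : (fun z : S => y z 0 k) =
      (fun z : S => f 0 k + (if k == i then 0 else eps k z.2) + (z.1 : R) * (k == i)%:R).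
    by apply/funext => z; rewrite !mxE eqxx.
  apply: measurable_funD; last exact: (measurable_funM mfst (measurable_cst _)).
  apply: measurable_funD => //; case: (boolP (k == i)) => [_|ki] //.
  apply: (@measurableT_comp _ _ _ _ _ _
    (eps k : g_sigma_algebraType (other_cylinders i) -> R)); last exact: measurable_snd.
  move=> _ A mA; rewrite setTI; apply: sub_sigma_algebra.
  exists (fun j => if j == k then A else setT); split.
    by move=> j; case: ifP.
  apply/seteqP; split => w /=; first by move=> wA j _; case: eqP => // ->.
  by move=> /(_ k ki); rewrite eqxx.
have mK : measurable_fun setT K.
  apply: (measurable_funB (measurable_funM mfst _) (measurable_funM (measurable_cst _) _)).
    exact: (mh _ _ _ my).
  exact: (mh' _ _ _ my).
have WE : (fun w => eps i w * h (f + noise w) - s ^+ 2 * h' (f + noise w)) =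
   (fun w => K (eps i w, w)).
  by apply/funext => w; rewrite /K yE.
have iK : P.-integrable setT (fun w => (K (eps i w, w))%:E).
  pose H (v : 'rV[R]_n) := v 0 i * h (f + v) - s ^+ 2 * h' (f + v).
  have -> : (fun w => (K (eps i w, w))%:E) = (fun w => (H (noise w))%:E).
    by apply/funext => w; rewrite /K yE /H mxE.
  apply: integrable_quadratic_noise s0 nrm _ _.
    move=> d' U v mv.
    have mfv k : measurable_fun setT (fun t => (f + v t) 0 k).
      by under eq_fun do rewrite mxE; exact: measurable_funD.
    apply: (measurable_funB (measurable_funM (mv i) _) (measurable_funM (measurable_cst _) _)).
      exact: (mh _ _ _ mfv).
    exact: (mh' _ _ _ mfv).
  exists (1 + (C + s ^+ 2 * C) * (2 + 2 * sqnorm f)) => v.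
  have hv := hC (f + v); have h'v := h'C (f + v); have fv := sqnormD_le f v.
  have Cfv := ler_wpM2l C0 fv.
  apply: (le_trans (ler_normB _ _)).
  have vi : v 0 i ^+ 2 <= sqnorm v.
    by rewrite /sqnorm (bigD1 i)//= lerDl; apply: sumr_ge0 => k _; exact: sqr_ge0.
  have : `|v 0 i * h (f + v)| <= 1 + sqnorm v + C * ((2 + 2 * sqnorm f) * (1 + sqnorm v)).
    rewrite normrM; apply: (@le_trans _ _ (v 0 i ^+ 2 + h (f + v) ^+ 2)); last first.
      apply: lerD; last exact: le_trans hv Cfv.
      by apply: le_trans vi _; rewrite lerDr.
    rewrite -[v 0 i ^+ 2]real_normK ?num_real// -[h _ ^+ 2]real_normK ?num_real//.
    have := sqr_ge0 (`|v 0 i| - `|h (f + v)|).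
    by have := normr_ge0 (v 0 i); have := normr_ge0 (h (f + v)); nra.
  have : `|s ^+ 2 * h' (f + v)| <= s ^+ 2 * (C * ((2 + 2 * sqnorm f) * (1 + sqnorm v))).
    rewrite normrM ger0_norm ?sqr_ge0//; apply: ler_wpM2l; first exact: sqr_ge0.
    exact: le_trans h'v Cfv.
  by move=> A B; apply: le_trans (lerD B A) _; rewrite le_eqVlt; apply/orP; left; apply/eqP; ring.
split; first by rewrite WE.
transitivity (\int[P]_w (K (eps i w, w))%:E)%E.
  by apply: eq_integral => w _; rewrite /K yE.
apply: (integral_iid_coord0 nrm mK iK) => w.
have sq x : 1 + sqnorm (y (x, w)) <= (2 + 2 * sqnorm (base w)) * (1 + x ^+ 2).
  by apply: le_trans (sqnormD_le _ _) _; rewrite sqnormZ sqnorm_delta mulr1.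
apply: (@integral_stein R s (C * (2 + 2 * sqnorm (base w)))
  (fun x => h (y (x, w))) (fun x => h' (y (x, w)))) => //.
- by move=> x; exact: (dh (base w) x).
- exact: (ch (base w)).
- by move=> x; apply: le_trans (hC _) _; rewrite -mulrA ler_wpM2l.
- by move=> x; apply: le_trans (h'C _) _; rewrite -mulrA ler_wpM2l.
Qed.

End GaussianStein.

(** * Orthogonal projections of row vectors *)

Section DotProduct.
Context {R : realType} {n : nat}.
Implicit Types (u v : 'rV[R]_n) (B Q : 'M[R]_n).

Definition dot u v : R := (u *m v^T) 0 0.

Lemma dotE u v : dot u v = \sum_k u 0 k * v 0 k.
Proof. by rewrite /dot mxE; apply: eq_bigr => k _; rewrite mxE. Qed.

Lemma dotC u v : dot u v = dot v u.
Proof. by rewrite !dotE; apply: eq_bigr => k _; rewrite mulrC. Qed.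

Lemma dotDl u u' v : dot (u + u') v = dot u v + dot u' v.
Proof. by rewrite /dot mulmxDl mxE. Qed.

Lemma dotBl u u' v : dot (u - u') v = dot u v - dot u' v.
Proof. by rewrite /dot mulmxBl !mxE. Qed.

Lemma dotZl (c : R) u v : dot (c *: u) v = c * dot u v.
Proof. by rewrite /dot -scalemxAl mxE. Qed.

Lemma dotDr u v v' : dot u (v + v') = dot u v + dot u v'.
Proof. by rewrite dotC dotDl !(dotC _ u). Qed.

Lemma dotBr u v v' : dot u (v - v') = dot u v - dot u v'.
Proof. by rewrite dotC dotBl !(dotC _ u). Qed.

Lemma dotZr (c : R) u v : dot u (c *: v) = c * dot u v.
Proof. by rewrite dotC dotZl dotC. Qed.

Lemma sqnorm_dot u : sqnorm u = dot u u.
Proof. by rewrite dotE. Qed.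

Lemma sqnormD u v : sqnorm (u + v) = sqnorm u + 2 * dot u v + sqnorm v.
Proof. by rewrite !sqnorm_dot dotDl !dotDr (dotC v u); ring. Qed.

Lemma sqnormB u v : sqnorm (u - v) = sqnorm u - 2 * dot u v + sqnorm v.
Proof. by rewrite !sqnorm_dot dotBl !dotBr (dotC v u); ring. Qed.

Lemma dot_delta u k : dot u (delta_mx 0 k) = u 0 k.
Proof.
rewrite dotE (bigD1 k)//= big1 => [|j /negbTE jk]; rewrite mxE ?jk ?andbF ?mulr0//.
by rewrite !eqxx mulr1 addr0.
Qed.

Lemma dot_deltal u k : dot (delta_mx 0 k) u = u 0 k.
Proof. by rewrite dotC dot_delta. Qed.

Lemma dot_suml N (w : 'I_N -> R) (v : 'I_N -> 'rV[R]_n) u :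
  dot (\sum_i w i *: v i) u = \sum_i w i * dot (v i) u.
Proof.
elim/big_ind2 : _ => [|x1 x2 y1 y2 <- <-|i _]; last by rewrite dotZl.
- by rewrite /dot mul0mx mxE.
- by rewrite dotDl.
Qed.

Definition orthoproj Q := Q^T = Q /\ Q *m Q = Q.

Lemma orthoproj_dot Q u v : orthoproj Q -> dot (u *m Q) v = dot u (v *m Q).
Proof. by move=> [QT _]; rewrite /dot trmx_mul QT mulmxA. Qed.

Lemma orthoproj_sqnorm Q u : orthoproj Q -> sqnorm (u *m Q) = dot u (u *m Q).
Proof. by move=> pQ; rewrite sqnorm_dot orthoproj_dot// -mulmxA pQ.2. Qed.

Lemma orthoproj_residual Q u : orthoproj Q ->
  sqnorm (u - u *m Q) = sqnorm u - sqnorm (u *m Q).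
Proof. by move=> pQ; rewrite sqnormB -orthoproj_sqnorm//; ring. Qed.

Lemma orthoproj_sqnorm_le Q u : orthoproj Q -> sqnorm (u *m Q) <= sqnorm u.
Proof. by move=> pQ; rewrite -subr_ge0 -orthoproj_residual// sqnorm_ge0. Qed.

(** A diagonal entry is the squared length of a projected unit vector. *)
Lemma orthoproj_diag Q k : orthoproj Q -> 0 <= Q k k <= 1.
Proof.
move=> pQ.
have -> : Q k k = sqnorm ((delta_mx 0 k : 'rV_n) *m Q).
  rewrite orthoproj_sqnorm// dotC dot_delta -rowE mxE//.
by rewrite sqnorm_ge0/= (le_trans (orthoproj_sqnorm_le _ pQ))// sqnorm_delta.
Qed.

End DotProduct.

(** * Calculus of the mixture *)

Lemma cvg_sumr {R : realType} (I : Type) (r : seq I) (f : I -> R -> R) (l : I -> R) (x : R) :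
  (forall i, f i @ x --> l i) ->
  (fun u => \sum_(i <- r) f i u) @ x --> \sum_(i <- r) l i.
Proof.
move=> fl; elim: r => [|i r IHr].
  by under eq_fun do rewrite big_nil; rewrite big_nil; exact: cvg_cst.
by under eq_fun do rewrite big_cons; rewrite big_cons; apply: cvgD.
Qed.

Section Mixture.
Context {R : realType} {n N : nat}.
Variables (Q : 'I_N -> 'M[R]_n) (p : 'I_N -> R) (s : R).
Hypotheses (pQ : forall i, orthoproj (Q i)) (p0 : forall i, 0 < p i) (s0 : 0 < s).
Hypothesis N0 : (0 < N)%N.

(** The parameters are abstract: any finite family of orthogonal projections
with positive prior weights.  For an orthogonal projection the trace is the
rank, and the trace is what the divergence of a linear fit produces. *)
Definition penalized_rss i (y : 'rV[R]_n) : R :=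
  sqnorm (y - y *m Q i) + 2 * \tr (Q i) * s ^+ 2 - n%:R * s ^+ 2.
Definition gibbs i (y : 'rV[R]_n) : R :=
  p i * expR (- penalized_rss i y / (4 * s ^+ 2)).
Definition partition_function y : R := \sum_i gibbs i y.
Definition gibbs_weight i y : R := gibbs i y / partition_function y.
Definition mixture y : 'rV[R]_n := \sum_i gibbs_weight i y *: (y *m Q i).

Lemma gibbs_gt0 i y : 0 < gibbs i y.
Proof. by rewrite mulr_gt0 ?expR_gt0. Qed.

Lemma partition_function_gt0 y : 0 < partition_function y.
Proof.
rewrite /partition_function (bigD1 (Ordinal N0))//= ltr_pwDl ?gibbs_gt0//.
by apply: sumr_ge0 => i _; exact/ltW/gibbs_gt0.
Qed.

Lemma gibbs_weight_ge0 i y : 0 <= gibbs_weight i y.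
Proof. by rewrite divr_ge0 ?ltW ?gibbs_gt0 ?partition_function_gt0. Qed.

Lemma sum_gibbs_weight y : \sum_i gibbs_weight i y = 1.
Proof. by rewrite -mulr_suml divff// gt_eqF// partition_function_gt0. Qed.

Lemma mixtureE y k : mixture y 0 k = \sum_i gibbs_weight i y * (y *m Q i) 0 k.
Proof. by rewrite summxE; apply: eq_bigr => i _; rewrite mxE. Qed.

(** The difference of the two sides is the variance of a under the weights. *)
Lemma gibbs_variance y (a : 'I_N -> R) :
  (\sum_i gibbs_weight i y * a i) ^+ 2 <= \sum_i gibbs_weight i y * a i ^+ 2.
Proof.
set m := \sum_i gibbs_weight i y * a i.
rewrite -subr_ge0.
have -> : \sum_i gibbs_weight i y * a i ^+ 2 - m ^+ 2 =
    \sum_i gibbs_weight i y * (a i - m) ^+ 2.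
  transitivity (\sum_i (gibbs_weight i y * a i ^+ 2 - 2 * m * (gibbs_weight i y * a i)
     + m ^+ 2 * gibbs_weight i y)); last by apply: eq_bigr => i _; ring.
  by rewrite !big_split/= sumrN -!mulr_sumr -/m sum_gibbs_weight; ring.
by apply: sumr_ge0 => i _; rewrite mulr_ge0 ?gibbs_weight_ge0 ?sqr_ge0.
Qed.

(** The partial derivative of the k-th coordinate of the mixture along the k-th
axis: the weighted diagonal entries, plus the contribution of the weights, which
is the weighted variance of the k-th fitted values over twice the noise
variance. *)
Definition mixture_deriv k y : R :=
  \sum_i gibbs_weight i y * Q i k k
  + (\sum_i gibbs_weight i y * (y *m Q i) 0 k ^+ 2 - mixture y 0 k ^+ 2) / (2 * s ^+ 2).

Lemma mixture_growth k : quadratic_growth (fun y => mixture y 0 k ^+ 2).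
Proof.
exists 1 => y; rewrite mul1r ger0_norm ?sqr_ge0// mixtureE.
apply: le_trans (gibbs_variance _ _) _.
apply: (@le_trans _ _ (\sum_i gibbs_weight i y * sqnorm y)).
  apply: ler_sum => i _; apply: ler_wpM2l; first exact: gibbs_weight_ge0.
  apply: le_trans (orthoproj_sqnorm_le y (pQ i)).
  by rewrite /sqnorm (bigD1 k)//= lerDl; apply: sumr_ge0 => j _; exact: sqr_ge0.
by rewrite -mulr_suml sum_gibbs_weight mul1r lerDr.
Qed.

Lemma mixture_deriv_growth k : quadratic_growth (mixture_deriv k).
Proof.
exists (1 + (2 * s ^+ 2)^-1) => y.
have s20 : 0 < 2 * s ^+ 2 by rewrite mulr_gt0// exprn_gt0.
have sq : \sum_i gibbs_weight i y * (y *m Q i) 0 k ^+ 2 <= sqnorm y.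
  apply: (@le_trans _ _ (\sum_i gibbs_weight i y * sqnorm y)).
    apply: ler_sum => i _; apply: ler_wpM2l; first exact: gibbs_weight_ge0.
    apply: le_trans (orthoproj_sqnorm_le y (pQ i)).
    by rewrite /sqnorm (bigD1 k)//= lerDl; apply: sumr_ge0 => j _; exact: sqr_ge0.
  by rewrite -mulr_suml sum_gibbs_weight mul1r.
have d0 : 0 <= \sum_i gibbs_weight i y * Q i k k.
  apply: sumr_ge0 => i _; rewrite mulr_ge0 ?gibbs_weight_ge0//.
  by case/andP: (orthoproj_diag k (pQ i)).
have d1 : \sum_i gibbs_weight i y * Q i k k <= 1.
  rewrite -(sum_gibbs_weight y); apply: ler_sum => i _.
  rewrite ler_piMr ?gibbs_weight_ge0//.
  by case/andP: (orthoproj_diag k (pQ i)).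
have var : mixture y 0 k ^+ 2 <= \sum_i gibbs_weight i y * (y *m Q i) 0 k ^+ 2.
  by rewrite mixtureE; exact: gibbs_variance.
have m0 := sqr_ge0 (mixture y 0 k).
rewrite /mixture_deriv ger0_norm; last first.
  by rewrite addr_ge0// divr_ge0 ?(ltW s20)// subr_ge0.
apply: (@le_trans _ _ (1 + sqnorm y / (2 * s ^+ 2))).
  apply: lerD => //; rewrite ler_pM2r ?invr_gt0//.
  by apply: le_trans sq; rewrite lerBlDr lerDl.
have := sqnorm_ge0 y; have : 0 <= (2 * s ^+ 2)^-1 by rewrite invr_ge0 ltW.
nra.
Qed.

Lemma mulmx_line (B : 'M[R]_n) (y : 'rV[R]_n) (u : R) k j :
  ((y + u *: delta_mx 0 k) *m B) 0 j = (y *m B) 0 j + u * B k j.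
Proof. by rewrite mulmxDl -scalemxAl -rowE !mxE. Qed.

(** Along a coordinate axis the penalized residual is a quadratic polynomial,
which reduces derivatives of the mixture to one-variable calculus. *)
Lemma penalized_rss_line i y k u :
  penalized_rss i (y + u *: delta_mx 0 k) =
  penalized_rss i y + 2 * u * (y 0 k - (y *m Q i) 0 k) + u ^+ 2 * (1 - Q i k k).
Proof.
rewrite /penalized_rss !orthoproj_residual// !orthoproj_sqnorm//.
rewrite mulmxDl sqnormD dotDl !dotDr -scalemxAl !dotZl !dotZr !sqnormZ sqnorm_delta.
rewrite -(orthoproj_dot y (delta_mx 0 k) (pQ i)) !dot_delta !dot_deltal.
by rewrite -rowE [row k _ _ _]mxE; ring.
Qed.

Lemma is_derive_gibbs i y k (x : R) :
  is_derive x 1 (fun u : R => gibbs i (y + u *: delta_mx 0 k))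
    (gibbs i (y + x *: delta_mx 0 k) *
     (((y + x *: delta_mx 0 k) *m Q i) 0 k - (y + x *: delta_mx 0 k) 0 k) / (2 * s ^+ 2)).
Proof.
rewrite mulmx_line [X in _ - X](_ : _ = y 0 k + x); last by rewrite !mxE !eqxx mulr1.
rewrite /gibbs; under eq_fun do rewrite penalized_rss_line.
apply: is_derive_eq.
rewrite /GRing.scale /= penalized_rss_line; field.
by rewrite gt_eqF.
Qed.

Lemma is_derive_ratio (f g : R -> R) (x f' g' : R) : g x != 0 ->
  is_derive x 1 f f' -> is_derive x 1 g g' ->
  is_derive x 1 (fun u => f u / g u) ((f' - f x / g x * g') / g x).
Proof.
move=> gx0 df dg.
have dV : is_derive x 1 (fun u => (g u)^-1) (- (g x) ^- 2 *: g').
  by apply: DeriveDef; [exact: derivableV|rewrite deriveV// derive_val].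
apply: is_derive_eq.
by rewrite /GRing.scale /=; field.
Qed.

(** The mixture is a quotient of two finite sums.  The quotient rule turns the
logarithmic derivatives of the weights, linear in the fits, into a variance. *)
Lemma is_derive_mixture k y (x : R) :
  is_derive x 1 (fun u : R => mixture (y + u *: delta_mx 0 k) 0 k)
    (mixture_deriv k (y + x *: delta_mx 0 k)).
Proof.
pose e := delta_mx 0 k : 'rV[R]_n.
have -> : (fun u : R => mixture (y + u *: e) 0 k) =
   (fun u => (\sum_i (fun u => gibbs i (y + u *: e) * ((y *m Q i) 0 k + u * Q i k k))) u /
             (\sum_i (fun u => gibbs i (y + u *: e))) u).
  apply/funext => u; rewrite mixtureE !fct_sumE mulr_suml; apply: eq_bigr => i _.
  by rewrite mulmx_line mulrAC.
pose Y := y + x *: e; pose a i := (Y *m Q i) 0 k.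
have Z0 : 0 < partition_function Y by exact: partition_function_gt0.
apply: is_derive_eq.
  apply: is_derive_ratio; first by rewrite fct_sumE gt_eqF.
  - apply: (is_derive_sum (dh := fun i => gibbs i Y * Q i k k +
      a i * (gibbs i Y * (a i - Y 0 k) / (2 * s ^+ 2)))) => i.
    have := is_derive_gibbs i y k x => dgi.
    apply: is_derive_eq.
    by rewrite /GRing.scale /= /a mulmx_line mulr0 !add0r mulr1 mul1r.
  - by apply: is_derive_sum => i; exact: is_derive_gibbs.
rewrite !fct_sumE -/e -/Y.
pose S1 := \sum_i gibbs i Y * a i; pose S2 := \sum_i gibbs i Y * a i ^+ 2.
pose SQ := \sum_i gibbs i Y * Q i k k; pose Z := partition_function Y.
have -> : \sum_i (gibbs i Y * Q i k k + a i * (gibbs i Y * (a i - Y 0 k) / (2 * s ^+ 2)))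
    = SQ + (S2 - Y 0 k * S1) / (2 * s ^+ 2).
  rewrite /SQ /S2 /S1 big_split/= mulr_sumr -sumrB mulr_suml; congr (_ + _).
  by apply: eq_bigr => i _; ring.
have -> : \sum_i gibbs i Y * ((y *m Q i) 0 k + x * Q i k k) = S1.
  by apply: eq_bigr => i _; rewrite /a mulmx_line.
have -> : \sum_(i < N) gibbs i Y * ((Y *m Q i) 0 k - Y 0 k) / (2 * s ^+ 2) =
    (S1 - Y 0 k * Z) / (2 * s ^+ 2).
  rewrite /S1 /Z mulr_sumr -sumrB mulr_suml; apply: eq_bigr => i _.
  by rewrite /a; ring.
rewrite -/(partition_function Y) -/Z /mixture_deriv mixtureE.
have -> : \sum_i gibbs_weight i Y * Q i k k = SQ / Z.
  by rewrite mulr_suml; apply: eq_bigr => i _; rewrite mulrAC.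
have -> : \sum_i gibbs_weight i Y * (Y *m Q i) 0 k ^+ 2 = S2 / Z.
  by rewrite mulr_suml; apply: eq_bigr => i _; rewrite mulrAC.
have -> : \sum_i gibbs_weight i Y * (Y *m Q i) 0 k = S1 / Z.
  by rewrite mulr_suml; apply: eq_bigr => i _; rewrite mulrAC.
by field; rewrite !gt_eqF.
Qed.

Lemma continuous_gibbs_weight i y k :
  continuous (fun x : R => gibbs_weight i (y + x *: delta_mx 0 k)).
Proof.
have cg j : continuous (fun x : R => gibbs j (y + x *: delta_mx 0 k)).
  move=> x; apply/differentiable_continuous/derivable1_diffP.
  by have [] := is_derive_gibbs j y k x.
move=> x; apply: cvgM; first exact: cg.
apply: cvgV; first by rewrite gt_eqF// partition_function_gt0.
by apply: cvg_sumr => j; exact: cg.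
Qed.

Lemma continuous_mixture_deriv k y :
  continuous (fun x : R => mixture_deriv k (y + x *: delta_mx 0 k)).
Proof.
move=> x; have ca i : (fun x : R => ((y + x *: delta_mx 0 k) *m Q i) 0 k) @ x -->
    ((y + x *: delta_mx 0 k) *m Q i) 0 k.
  rewrite mulmx_line (_ : (fun _ => _) = fun u => (y *m Q i) 0 k + u * Q i k k); last first.
    by apply/funext => u; rewrite mulmx_line.
  by apply: cvgD; [exact: cvg_cst|apply: cvgM; [exact: cvg_id|exact: cvg_cst]].
have cm : (fun x : R => mixture (y + x *: delta_mx 0 k) 0 k) @ x -->
    mixture (y + x *: delta_mx 0 k) 0 k.
  apply/differentiable_continuous/derivable1_diffP.
  by have [] := is_derive_mixture k y x.
apply: cvgD; first apply: cvg_sumr => i.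
  by apply: cvgM; [exact: continuous_gibbs_weight|exact: cvg_cst].
apply: cvgM; last exact: cvg_cst.
apply: cvgB; last by apply: cvgM.
apply: cvg_sumr => i.
by apply: cvgM; [exact: continuous_gibbs_weight|apply: cvgM].
Qed.

Lemma measurable_mulmx (B : 'M[R]_n) k : coord_measurable (fun y : 'rV[R]_n => (y *m B) 0 k).
Proof.
move=> d S y my; rewrite /comp; under eq_fun do rewrite mxE.
by apply: measurable_sum => j; apply: measurable_funM.
Qed.

Lemma measurable_gibbs_weight i : coord_measurable (gibbs_weight i).
Proof.
have mg j : coord_measurable (gibbs j).
  move=> d S y my; apply: measurable_funM => //; apply: measurableT_comp => //.
  apply: measurable_funM => //; apply: measurableT_comp => //.
  apply: measurable_funB => //; apply: measurable_funD => //.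
  apply: measurable_sum => k; apply: measurable_funX.
  under eq_fun do rewrite !mxE; apply: measurable_funB => //.
  by apply: measurable_sum => l; apply: measurable_funM.
move=> d S y my.
(* Division by the partition function is written with exp and ln, which are
   measurable on the whole line. *)
have -> : gibbs_weight i \o y = (fun t => gibbs i (y t) * expR (- ln (partition_function (y t)))).
  by apply/funext => t; rewrite expRN lnK// posrE partition_function_gt0.
apply: measurable_funM; first exact: mg.
do 3 (apply: measurableT_comp => //).
by apply: measurable_sum => j; exact: mg.
Qed.

Lemma measurable_mixture k : coord_measurable (fun y => mixture y 0 k).
Proof.
move=> d S y my; rewrite /comp; under eq_fun do rewrite mixtureE.
apply: measurable_sum => i; apply: measurable_funM; first exact: measurable_gibbs_weight.
exact: measurable_mulmx.
Qed.

Lemma measurable_mixture_deriv k : coord_measurable (mixture_deriv k).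
Proof.
move=> d S y my; apply: measurable_funD.
  apply: measurable_sum => i; apply: measurable_funM => //.
  exact: measurable_gibbs_weight.
apply: measurable_funM => //; apply: measurable_funB; last first.
  by apply: measurable_funX; exact: measurable_mixture.
apply: measurable_sum => i; apply: measurable_funM; first exact: measurable_gibbs_weight.
by apply: measurable_funX; exact: measurable_mulmx.
Qed.

(** The left side is Stein's unbiased risk estimate of the mixture.  The variance
term in [mixture_deriv] has the coefficient one after multiplication by
2 s^2, so it cancels against the gap between the mean squared residual and
the squared residual of the mean. *)
Lemma sum_penalized_rss (y : 'rV[R]_n) :
  sqnorm (y - mixture y) + 2 * s ^+ 2 * (\sum_k mixture_deriv k y) - n%:R * s ^+ 2 =
  \sum_i gibbs_weight i y * penalized_rss i y.
Proof.
pose A := \sum_i gibbs_weight i y * sqnorm (y *m Q i).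
pose D := \sum_i gibbs_weight i y * \tr (Q i).
have -> : \sum_k mixture_deriv k y = D + (A - sqnorm (mixture y)) / (2 * s ^+ 2).
  rewrite /mixture_deriv big_split/= -mulr_suml sumrB; congr (_ + _).
    rewrite exchange_big /D; apply: eq_bigr => i _.
    by rewrite /mxtrace mulr_sumr.
  congr ((_ - _) / _); rewrite exchange_big /A; apply: eq_bigr => i _.
  by rewrite /sqnorm mulr_sumr.
have dy : dot y (mixture y) = A.
  rewrite dotC dot_suml; apply: eq_bigr => i _.
  by rewrite dotC orthoproj_sqnorm.
rewrite sqnormB dy.
have -> : \sum_i gibbs_weight i y * penalized_rss i y =
   \sum_i ((sqnorm y - n%:R * s ^+ 2) * gibbs_weight i y
     - gibbs_weight i y * sqnorm (y *m Q i)
     + 2 * s ^+ 2 * (gibbs_weight i y * \tr (Q i))).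
  by apply: eq_bigr => i _; rewrite /penalized_rss orthoproj_residual//; ring.
rewrite big_split/= sumrB -!mulr_sumr sum_gibbs_weight -/A -/D; field.
by rewrite gt_eqF.
Qed.

(** The energy of i is 4 s^2 (ln (p i) - ln (w i) - ln Z).  Averaging over the
weights w, the relative entropy term is nonpositive because the total mass of
the prior is at most one, and Z is at least any one of its summands. *)
Lemma gibbs_variational y j : \sum_i p i <= 1 ->
  \sum_i gibbs_weight i y * penalized_rss i y <=
  penalized_rss j y + 4 * s ^+ 2 * ln (p j)^-1.
Proof.
move=> p1.
have s4 : 0 < 4 * s ^+ 2 by rewrite mulr_gt0// exprn_gt0.
have Z0 := partition_function_gt0 y; have w0 i : 0 < gibbs_weight i y.
  by rewrite divr_gt0 ?gibbs_gt0.
have lng i : penalized_rss i y = 4 * s ^+ 2 * (ln (p i) - ln (gibbs i y)).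
  by rewrite /gibbs lnM ?posrE ?expR_gt0// expRK; field; rewrite gt_eqF.
have lnw i : ln (gibbs i y) = ln (gibbs_weight i y) + ln (partition_function y).
  by rewrite -lnM ?posrE// /gibbs_weight divfK// gt_eqF.
apply: (@le_trans _ _ (4 * s ^+ 2 *
    (\sum_i (p i - gibbs_weight i y * (1 + ln (partition_function y)))))).
  rewrite mulr_sumr; apply: ler_sum => i _.
  rewrite lng lnw mulrCA ler_pM2l//.
  have : ln (p i / gibbs_weight i y) <= p i / gibbs_weight i y - 1.
    rewrite -[X in ln X](addrNK 1) addrC le_ln1Dx// ltrBDr addNr.
    by rewrite divr_gt0.
  rewrite lnM ?posrE ?invr_gt0// lnV ?posrE// => H.
  have := ler_wpM2l (ltW (w0 i)) H.
  have -> : gibbs_weight i y * (p i / gibbs_weight i y - 1) = p i - gibbs_weight i y.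
    by field; rewrite gt_eqF.
  nra.
rewrite sumrB -mulr_suml sum_gibbs_weight mul1r.
rewrite [X in _ <= X + _]lng -mulrDr ler_pM2l// lnV ?posrE//.
have : ln (gibbs j y) <= ln (partition_function y).
  rewrite ler_ln ?posrE ?gibbs_gt0// /partition_function (bigD1 j)//= lerDl.
  by apply: sumr_ge0 => i _; exact/ltW/gibbs_gt0.
lra.
Qed.

End Mixture.

(** * The oracle inequality for Gibbs mixtures *)

Section CenteredAlgebra.
Context d (T : measurableType d) (R : realType) (P : probability T R).

Lemma centered0 : centered P (fun=> 0).
Proof. by split; [exact: finite_measure_integrable_cst|exact: integral0]. Qed.

Lemma centeredD (U V : T -> R) : centered P U -> centered P V ->
  centered P (fun w => U w + V w).
Proof.
move=> [iU U0] [iV V0]; split.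
  have -> : EFin \o (fun w => U w + V w) = (EFin \o U) \+ (EFin \o V) by [].
  exact: integrableD.
under eq_integral do rewrite EFinD.
by rewrite integralD//= U0 V0 adde0.
Qed.

Lemma centeredZ (c : R) (U : T -> R) : centered P U -> centered P (fun w => c * U w).
Proof.
move=> [iU U0]; split.
  have -> : EFin \o (fun w => c * U w) = (fun w => c%:E * (EFin \o U) w)%E by [].
  exact: integrableZl.
under eq_integral do rewrite EFinM.
by rewrite integralZl//= U0 mule0.
Qed.

Lemma centered_sum n (U : 'I_n -> T -> R) : (forall k, centered P (U k)) ->
  centered P (fun w => \sum_k U k w).
Proof.
move=> cU; elim: (index_enum _) => [|k r IHr].
  by under eq_fun do rewrite big_nil; exact: centered0.
by under eq_fun do rewrite big_cons; exact: centeredD.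
Qed.

Lemma integral_le_centered (U V : T -> R) (c : R) : centered P V ->
  measurable_fun setT U -> (forall w, 0 <= U w) -> (forall w, U w <= c + V w) ->
  (\int[P]_w (U w)%:E <= c%:E)%E.
Proof.
move=> [iV V0] mU U0 UV.
have ic : P.-integrable setT (fun=> c%:E) by exact: finite_measure_integrable_cst.
apply: (@le_trans _ _ (\int[P]_w (c%:E + (V w)%:E))%E).
  apply: ge0_le_integral => //.
  - by move=> w _; rewrite lee_fin.
  - by apply/measurable_EFinP.
  - by apply: emeasurable_funD => //; exact: measurable_int iV.
  - by move=> w _; rewrite -EFinD lee_fin.
by rewrite integralD// V0 adde0 integral_cst//= probability_setT mule1.
Qed.

End CenteredAlgebra.

Section OracleInequality.
Context d (T : measurableType d) (R : realType) (P : probability T R).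
Variables (n N : nat) (eps : 'I_n -> {RV P >-> R}) (s : R).
Hypotheses (s0 : 0 < s) (nrm : iid_normal eps s).
Let noise w : 'rV[R]_n := \row_j eps j w.

(** The linear case of Stein's identity yields every moment of the noise that the
risk of a projection involves, including the variance. *)
Lemma centered_affine (f : 'rV[R]_n) (B : 'M[R]_n) (c : R) k :
  centered P (fun w => eps k w * (((f + noise w) *m B) 0 k + c) - s ^+ 2 * B k k).
Proof.
apply: (@centered_stein _ _ _ P _ eps s k f (fun y => (y *m B) 0 k + c) (fun=> B k k)) => //.
- move=> d' S y my; apply: measurable_funD => //.
  exact: (measurable_mulmx _ _ my).
- by move=> d' S y my; exact: measurable_cst.
- move=> y x; under eq_fun do rewrite mulmx_line.
  by apply: is_derive_eq; rewrite /GRing.scale /=; ring.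
- by move=> y x; exact: cvg_cst.
- pose D := \sum_j `|B j k|.
  exists (2 * c ^+ 2 + 2 * D ^+ 2) => y.
  have : `|(y *m B) 0 k| <= D * Num.sqrt (sqnorm y).
    rewrite mxE; apply: (le_trans (ler_norm_sum _ _ _)); rewrite /D mulr_suml.
    apply: ler_sum => j _; rewrite normrM mulrC ler_wpM2l//.
    rewrite -sqrtr_sqr; apply: ler_wsqrtr.
    by rewrite /sqnorm (bigD1 j)//= lerDl; apply: sumr_ge0 => l _; exact: sqr_ge0.
  have D0 : 0 <= D by apply: sumr_ge0.
  have := sqr_sqrtr (sqnorm_ge0 y); have := sqrtr_ge0 (sqnorm y).
  set r := Num.sqrt _ => r0 r2; rewrite -r2 => yB.
  have yB2 : ((y *m B) 0 k) ^+ 2 <= (D * r) ^+ 2.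
    by rewrite -[leLHS]real_normK ?num_real// ler_sqr// nnegrE mulr_ge0.
  rewrite ger0_norm ?sqr_ge0//.
  have := sqr_ge0 ((y *m B) 0 k - c); have := sqr_ge0 (c * r); have := sqr_ge0 D.
  by move: yB2; rewrite !exprMn; nra.
- exists `|B k k| => y; rewrite ler_peMr// lerDl sqnorm_ge0//.
Qed.

Variables (Q : 'I_N -> 'M[R]_n) (p : 'I_N -> R) (f : 'rV[R]_n).
Hypotheses (pQ : forall i, orthoproj (Q i)) (p0 : forall i, 0 < p i) (p1 : \sum_i p i <= 1).

Lemma measurable_mixture_loss : (0 < N)%N ->
  measurable_fun setT (fun w => sqnorm (mixture Q p s (f + noise w) - f)).
Proof.
move=> N0; apply: measurable_sum => k; apply: measurable_funX.
under eq_fun do rewrite !mxE; apply: measurable_funB => //.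
apply: (@measurable_mixture _ _ _ _ _ _ _ _ k) => // l.
by under eq_fun do rewrite !mxE; apply: measurable_funD => //; exact: measurable_funPT.
Qed.

(** The loss is bounded pointwise by the stated price plus a sum of Stein terms:
one for the mixture, one for the residual of the j-th projection and one for
the squared norm of the noise. *)
Theorem oracle_inequality j :
  (\int[P]_w (sqnorm (mixture Q p s (f + noise w) - f))%:E <=
   (sqnorm (f *m Q j - f) + s ^+ 2 * \tr (Q j) + 4 * s ^+ 2 * ln (p j)^-1)%:E)%E.
Proof.
have N0 : (0 < N)%N by exact: leq_ltn_trans (leq0n j) (ltn_ord j).
pose B := 1%:M - Q j.
(* The affine terms add - f + f B to the second summand and 0 to the third;
   their Stein corrections are unchanged by constants. *)
pose V w := \sum_k (2 * (eps k w * mixture Q p s (f + noise w) 0 k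
                       - s ^+ 2 * mixture_deriv Q p s k (f + noise w))
   + (eps k w * (((f + noise w) *m B) 0 k + (- f 0 k + (f *m B) 0 k)) - s ^+ 2 * B k k)
   + (-1) * (eps k w * (((f + noise w) *m 1%:M) 0 k + 0) - s ^+ 2 * 1%:M k k)).
apply: (@integral_le_centered _ _ _ _ _ V).
- apply: centered_sum => k; apply: centeredD; last by apply: centeredZ; exact: centered_affine.
  apply: centeredD; last exact: centered_affine.
  apply: centeredZ.
  apply: (@centered_stein _ _ _ P _ eps s k f (fun y => mixture Q p s y 0 k)) => //.
  + exact: measurable_mixture.
  + exact: measurable_mixture_deriv.
  + by move=> y x; exact: is_derive_mixture.
  + by move=> y; exact: continuous_mixture_deriv.
  + exact: mixture_growth.
  + exact: mixture_deriv_growth.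
- exact: measurable_mixture_loss.
- by move=> w; exact: sqnorm_ge0.
move=> w; set y := f + noise w; set m := mixture Q p s y.
pose S := \sum_k mixture_deriv Q p s k y.
have en k : eps k w = noise w 0 k by rewrite mxE.
have trB : \sum_k B k k = n%:R - \tr (Q j).
  by rewrite -/(mxtrace B) mxtraceD mxtrace1 raddfN.
have VE : V w = 2 * dot (noise w) m - 2 * s ^+ 2 * S
   + (dot (noise w) (y *m B - (f - f *m B)) - s ^+ 2 * (n%:R - \tr (Q j)))
   - (dot (noise w) y - s ^+ 2 * n%:R).
  rewrite /V !big_split/= sumrN -!mulr_sumr !sumrB -!mulr_sumr trB -/(mxtrace 1%:M) mxtrace1 -/S.
  rewrite mulmx1 mulN1r !dotE; congr (_ + (_ - _) - (_ - _)).
  - rewrite mulrBr mulrA; congr (_ * _ - _).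
    by apply: eq_bigr => k _; rewrite en.
  - by apply: eq_bigr => k _; rewrite en !mxE opprB [- f 0 k + _]addrC.
  - by apply: eq_bigr => k _; rewrite en addr0.
have yf : noise w = y - f by rewrite /y addrC addKr.
have H := gibbs_variational Q p0 s0 N0 y j p1.
rewrite -sum_penalized_rss// -/m -/S in H.
have rssE : penalized_rss Q s j y = dot y (y *m B) + 2 * \tr (Q j) * s ^+ 2 - n%:R * s ^+ 2.
  rewrite /penalized_rss orthoproj_residual// orthoproj_sqnorm//.
  by rewrite /B mulmxBr mulmx1 dotBr -sqnorm_dot.
have -> : sqnorm (f *m Q j - f) = dot f (f *m B).
  rewrite -[_ - f]opprB -scaleN1r sqnormZ sqrrN expr1n mul1r.
  by rewrite orthoproj_residual// orthoproj_sqnorm// /B mulmxBr mulmx1 dotBr -sqnorm_dot.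
have sym : dot y (f *m B) = dot f (y *m B).
  by rewrite /B !mulmxBr !mulmx1 !dotBr (dotC y f) -orthoproj_dot// (dotC (y *m _)).
rewrite VE yf; move: H; rewrite rssE !sqnormB !sqnorm_dot !(dotBl, dotBr) sym.
rewrite (dotC m f) (dotC y f).
lra.
Qed.

End OracleInequality.

(** * Projection onto a column span *)

Section ColumnProjection.
Context {R : realType} {n p : nat}.
Implicit Types (A : 'M[R]_(n, p)) (v : 'rV[R]_n).

Lemma sqnorm_eq0 v : sqnorm v = 0 -> v = 0.
Proof.
move=> /eqP; rewrite psumr_eq0 => [/allP v0|k _]; last exact: sqr_ge0.
by apply/rowP => k; apply/eqP; rewrite mxE -sqrf_eq0; apply: v0; rewrite mem_index_enum.
Qed.

(** A vector of the column span orthogonal to the columns is orthogonal to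
itself; over the reals it vanishes. *)
Lemma span_cap_ker A : (<<A^T>> :&: kermx A)%MS = 0.
Proof.
apply/eqP/rowV0P => v; rewrite sub_capmx genmxE => /andP[/submxP[w vE] /sub_kermxP vA].
by apply: sqnorm_eq0; rewrite sqnorm_dot /dot {1}vE -mulmxA -trmx_mul vA trmx0 mulmx0 mxE.
Qed.

Lemma span_add_ker A (B : 'M[R]_n) : (B <= <<A^T>> + kermx A)%MS.
Proof.
apply: submx_full; rewrite /row_full mxrank_disjoint_sum ?span_cap_ker//.
by rewrite genmxE mxrank_tr mxrank_ker subnKC ?rank_leq_row.
Qed.

Lemma colproj_compl A : (1%:M - colproj A) *m A = 0.
Proof.
apply/sub_kermxP; have := proj_mx_compl_sub (span_add_ker A 1%:M).
by rewrite mul1mx.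
Qed.

Lemma colproj_orthoproj A : orthoproj (colproj A).
Proof.
have /submxP[W PE] : (colproj A <= A^T)%MS.
  by have := proj_mx_sub <<A^T>>%MS (kermx A) 1%:M; rewrite mul1mx genmxE.
have PP : colproj A *m (1%:M - colproj A)^T = 0.
  by rewrite {1}PE -mulmxA -trmx_mul colproj_compl trmx0 mulmx0.
have PPT : colproj A = colproj A *m (colproj A)^T.
  apply/eqP; rewrite -subr_eq0 -{1}(mulmx1 (colproj A)) -mulmxBr.
  by rewrite -[1%:M in X in X == _]trmx1 -linearB/= PP.
have PT : (colproj A)^T = colproj A by rewrite PPT trmx_mul trmxK -PPT.
by split => //; rewrite -{2}PT -PPT.
Qed.

(** For a full-rank factorisation C D of an idempotent, D C is the identity of
size the rank, and it has the same trace. *)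
Lemma idempotent_trace (Q : 'M[R]_n) : Q *m Q = Q -> \tr Q = (\rank Q)%:R.
Proof.
move=> QQ.
have : forall (C : 'M[R]_(n, \rank Q)) (D : 'M[R]_(\rank Q, n)),
    row_full C -> row_free D -> C *m D = Q -> \tr Q = (\rank Q)%:R.
  move=> C D fC fD CD.
  have DC : D *m C = 1%:M.
    apply: (row_free_inj fD); apply: (row_full_inj fC).
    by rewrite /= mul1mx !mulmxA CD -mulmxA CD QQ.
  by rewrite -{1}CD mxtrace_mulC DC mxtrace1.
move=> /(_ _ _ (col_base_full Q) (row_base_free Q)); apply; exact: mulmx_base.
Qed.

Lemma colproj_trace A : \tr (colproj A) = (\rank A)%:R.
Proof.
rewrite idempotent_trace; last by have [] := colproj_orthoproj A.
congr (_%:R); apply/eqP; rewrite eqn_leq; apply/andP; split.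
  have := proj_mx_sub <<A^T>>%MS (kermx A) 1%:M; rewrite mul1mx => /mxrankS.
  by rewrite genmxE mxrank_tr.
have : A = colproj A *m A.
  by apply/eqP; rewrite -subr_eq0 -{1}(mul1mx A) -mulmxBl colproj_compl.
by move=> {1}->; exact: mxrankM_maxl.
Qed.

Lemma colproj_id A (w : 'rV[R]_p) : (w *m A^T) *m colproj A = w *m A^T.
Proof. by apply: proj_mx_id; [exact: span_cap_ker|rewrite genmxE submxMl]. Qed.

Lemma orthoproj_best (Q : 'M[R]_n) f v : orthoproj Q -> v *m Q = v ->
  sqnorm (f *m Q - f) <= sqnorm (v - f).
Proof.
move=> pQ vQ.
have -> : v - f = (v - f *m Q) + (f *m Q - f) by rewrite addrA subrK.
have d0 : dot (v - f *m Q) (f *m Q - f) = 0.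
  rewrite -{1}vQ -mulmxBl orthoproj_dot// mulmxBl -mulmxA pQ.2 subrr.
  by rewrite /dot trmx0 mulmx0 mxE.
by rewrite (sqnormD (v - _)) d0 mulr0 addr0 lerDr sqnorm_ge0.
Qed.

End ColumnProjection.

(** * The oracle inequality over the models *)

Section ModelPrior.
Variables (R : realType) (n M : nat).

(** Models carry no decidable equality, so the family is indexed by the positions
in the enumeration. *)
Definition Gamma_nth (i : 'I_(size (Gamma n M))) : model M := tnth (in_tuple (Gamma n M)) i.

Lemma big_Gamma (V : nmodType) (F : model M -> V) :
  \sum_(J <- Gamma n M) F J = \sum_i F (Gamma_nth i).
Proof. by rewrite (big_tnth _ _ (Gamma n M)). Qed.

Definition in_Gamma (J : model M) : Prop :=
  match J with
  | SubModel U => (1 <= #|U| <= minn (M - 1) n)%N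
  | _ => True
  end.

Lemma in_Gamma_nth J : in_Gamma J -> exists i, Gamma_nth i = J.
Proof.
have sz k : (k < 3)%N -> (k < size (Gamma n M))%N.
  by rewrite /Gamma size_cat /= => k3; exact: leq_trans k3 (leq_addr _ _).
have nthE i : Gamma_nth i = nth FullModel (Gamma n M) i.
  by rewrite /Gamma_nth (tnth_nth FullModel).
case: J => [U /= HU| | |] ; last 3 first.
- by exists (Ordinal (sz 0 isT)); rewrite nthE.
- by exists (Ordinal (sz 1 isT)); rewrite nthE.
- by exists (Ordinal (sz 2 isT)); rewrite nthE.
set E := enum [pred U : {set 'I_M} | (1 <= #|U| <= minn (M - 1) n)%N].
have UE : U \in E by rewrite mem_enum inE.
have lt : (3 + index U E < size (Gamma n M))%N.
  by rewrite /Gamma size_cat size_map ltn_add2l index_mem.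
exists (Ordinal lt); rewrite nthE /Gamma /=.
by rewrite (nth_map U) ?index_mem// nth_index.
Qed.

Lemma Gamma_nth_in i : in_Gamma (Gamma_nth i).
Proof.
rewrite /Gamma_nth (tnth_nth FullModel) /= .
case: i => -[|[|[|i]]] //= lti.
have {}lti : (i < size (enum [pred U : {set 'I_M} | (1 <= #|U| <= minn (M - 1) n)%N]))%N.
  by move: lti; rewrite /= size_map.
rewrite (nth_map finset.set0)//=.
by have := mem_nth finset.set0 lti; rewrite mem_enum inE.
Qed.

Lemma prior_gt0 J : in_Gamma J -> 0 < prior R n J.
Proof.
case: J => [U /= /andP[U1 Um]|_|_|_]; last 3 first.
- by rewrite divr_gt0.
- by rewrite divr_gt0.
- by rewrite divr_gt0.
rewrite !divr_gt0// mulr_gt0 ?ltr0n//; first exact: leq_trans U1 Um.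
by rewrite bin_gt0 -[X in (_ <= X)%N]card_ord max_card.
Qed.

(** Each size between 1 and min(M - 1, n) receives the same share of 0.85, split
evenly among the models of that size; the three special models add 0.15.  The
sum falls below one when there is no proper submodel. *)
Lemma sum_prior : \sum_i prior R n (Gamma_nth i) <= 1.
Proof.
rewrite -big_Gamma /Gamma big_cat /= !big_cons big_nil big_map big_enum /=.
set mm := minn (M - 1) n.
have : \sum_(U : {set 'I_M} | (0 < #|U| <= mm)%N) prior R n (SubModel U) <= 85%:R / 100%:R.
  rewrite (partition_big (fun U : {set 'I_M} => (inord #|U| : 'I_mm.+1))
    (fun m => 0 < m)%N)/=; last first.
    by move=> U /andP[U1 Um]; rewrite inordK.
  have [mm0|mm0] := posnP mm.
    rewrite big1 ?divr_ge0// => m m0; exfalso.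
    by move: (ltn_ord m) m0; rewrite {2}mm0 ltnS leqn0 => /eqP ->.
  have le (m : 'I_mm.+1) : (0 < m)%N ->
      \sum_(U : {set 'I_M} | (0 < #|U| <= mm)%N && ((inord #|U| : 'I_mm.+1) == m))
      prior R n (SubModel U) <= 85%:R / 100%:R / mm%:R.
    move=> m0.
    apply: (@le_trans _ _ (\sum_(U : {set 'I_M} | #|U| == m)
        85%:R / 100%:R / (mm%:R * 'C(M, m)%:R))).
      rewrite big_mkcond [leRHS]big_mkcond; apply: ler_sum => U _.
      case: ifPn => [/andP[/andP[U1 Um] /eqP Em]|_].
        have Um' : #|U| = m by rewrite -Em inordK.
        by rewrite /prior Um' eqxx.
      by case: ifP => //; rewrite !divr_ge0// mulr_ge0.
    rewrite sumr_const.
    have -> : #|[pred U : {set 'I_M} | #|U| == m]| = 'C(M, m).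
      by rewrite -[in RHS](card_ord M) -card_draws cardsE.
    have [->|C0] := posnP 'C(M, m); first by rewrite mulr0n !divr_ge0.
    rewrite -[leLHS]mulr_natr invfM !mulrA mulfVK// pnatr_eq0 -lt0n//.
  apply: (@le_trans _ _ (\sum_(m < mm.+1 | (0 < m)%N) 85%:R / 100%:R / mm%:R)).
    by apply: ler_sum => m; exact: le.
  rewrite big_mkcond big_ord_recl /= add0r sumr_const card_ord -[leLHS]mulr_natr.
  by rewrite divfK// pnatr_eq0 -lt0n.
lra.
Qed.

End ModelPrior.

Section ModelOracle.
Context d (T : measurableType d) (R : realType) (P : probability T R).
Variables (n M : nat) (eps : 'I_n -> {RV P >-> R}) (sigma : R).
Variables (X : 'M[R]_(n, M)) (f0 : 'rV[R]_M -> R).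
Hypotheses (n0 : (0 < n)%N) (s0 : 0 < sigma) (nrm : iid_normal eps sigma).

Let Q i := colproj (model_design X (@Gamma_nth n M i)).
Let p i := prior R n (@Gamma_nth n M i).

Lemma fMLS_mixture y : fMLS sigma X y = mixture Q p sigma y.
Proof.
have eE i : risk_estimate sigma X y (@Gamma_nth n M i) = penalized_rss Q sigma i y.
  rewrite /risk_estimate /penalized_rss /normn2 mulrC divfK ?pnatr_eq0 -?lt0n//.
  by rewrite colproj_trace.
have rE i : raw_weight sigma X y (@Gamma_nth n M i) = gibbs Q p sigma i y.
  by rewrite /raw_weight eE.
rewrite /fMLS /mixture big_Gamma; apply: eq_bigr => i _.
rewrite /weight big_Gamma rE /gibbs_weight /partition_function; congr (_ / _ *: _).
by apply: eq_bigr => j _; exact: rE.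
Qed.

Theorem risk_le_model J : in_Gamma n J ->
  (risk_MLS eps sigma X f0 <=
    (normn2 (model_fit X J (at_design X f0) - at_design X f0)
     + sigma ^+ 2 * (model_rank X J)%:R / n%:R
     + 4 * sigma ^+ 2 * ln (prior R n J)^-1 / n%:R)%:E)%E.
Proof.
move=> /in_Gamma_nth[j jE]; set f := at_design X f0.
have pQ i : orthoproj (Q i) by exact: colproj_orthoproj.
have p0 i : 0 < p i by apply: prior_gt0; exact: Gamma_nth_in.
have := oracle_inequality s0 nrm f pQ p0 (sum_prior R n M) j.
rewrite /Q /p jE colproj_trace -/(model_rank X J) -/(model_fit X J f) => H.
have N0 : (0 < size (Gamma n M))%N by exact: leq_ltn_trans (leq0n j) (ltn_ord j).
have mloss := measurable_mixture_loss eps sigma Q f p0 N0.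
have nV : (0 <= n%:R^-1 :> R) by rewrite invr_ge0.
have -> : risk_MLS eps sigma X f0 =
    (n%:R^-1%:E * \int[P]_w (sqnorm (mixture Q p sigma (f + \row_j eps j w) - f))%:E)%E.
  rewrite /risk_MLS unlock -ge0_integralZl//=; last 2 first.
  - by apply/measurable_EFinP; exact: mloss.
  - by move=> w _; rewrite lee_fin sqnorm_ge0.
  apply: eq_integral => w _; rewrite -EFinM; congr (_%:E).
  by rewrite /ASE /normn2 fMLS_mixture -/f mulrC.
apply: le_trans (lee_wpmul2l _ H) _; first by rewrite lee_fin.
rewrite -EFinM lee_fin le_eqVlt; apply/orP; left; apply/eqP.
by rewrite /normn2 -/f -/(sqnorm _); ring.
Qed.

End ModelOracle.

(** * Sparse approximation by sampling columns *)

Section Maurey.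
Context {R : realType} {n : nat}.

(** When j is drawn with the weights w, the increment has mean zero, so the
expected squared norm grows by the variance, and some j does no worse than the
expectation. *)
Lemma maurey_step (I : finType) (w : I -> R) (u : I -> 'rV[R]_n) (g : 'rV[R]_n) (c : R) :
  (forall j, 0 <= w j) -> \sum_j w j = 1 ->
  exists j, sqnorm (g + c *: (u j - \sum_k w k *: u k)) <=
            sqnorm g + c ^+ 2 * \sum_k w k * sqnorm (u k).
Proof.
move=> w0 w1; set m := \sum_k w k *: u k; set V := \sum_k w k * sqnorm (u k).
have dsum v : \sum_j w j * dot v (u j) = dot v m.
  rewrite /m; elim/big_ind2 : _ => [|x1 x2 y1 y2 -> ->|j _]; last by rewrite dotZr.
    by rewrite /dot trmx0 mulmx0 mxE.
  by rewrite dotDr.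
have avg : \sum_j w j * sqnorm (g + c *: (u j - m)) =
    sqnorm g + c ^+ 2 * (V - sqnorm m).
  transitivity (\sum_j (w j * (sqnorm g - 2 * c * dot g m + c ^+ 2 * sqnorm m)
     + (2 * c) * (w j * dot g (u j)) + c ^+ 2 * (w j * sqnorm (u j))
     - (2 * c ^+ 2) * (w j * dot m (u j)))).
    apply: eq_bigr => j _; rewrite sqnormD sqnormZ dotZr dotBr sqnormB (dotC (u j) m); ring.
  rewrite sumrB !big_split/= -mulr_suml -!mulr_sumr w1 !dsum -/V -sqnorm_dot; ring.
apply: contrapT => /forallNP H.
have : \sum_j w j * (sqnorm g + c ^+ 2 * V) < \sum_j w j * sqnorm (g + c *: (u j - m)).
  have [j wj] : exists j, 0 < w j.
    apply: contrapT => /forallNP N; suff : (1 : R) = 0 by move/eqP; rewrite oner_eq0.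
    rewrite -w1 big1// => j _; apply/eqP; rewrite eq_le w0 andbT leNgt.
    exact/negP/N.
  rewrite (bigD1 j)//= [ltRHS](bigD1 j)//=; apply: ltr_leD.
    by rewrite ltr_pM2l// ltNge; exact/negP/H.
  apply: ler_sum => k _; apply: ler_wpM2l => //; apply/ltW; rewrite ltNge.
  exact/negP/H.
rewrite -mulr_suml w1 mul1r avg ltrD2l mulrBr ltNge => /negP; apply.
by rewrite gerBl mulr_ge0 ?sqr_ge0 ?sqnorm_ge0.
Qed.

Lemma maurey (I : finType) (w : I -> R) (u : I -> 'rV[R]_n) (g : 'rV[R]_n) (c : R) (b : nat) :
  (forall j, 0 <= w j) -> \sum_j w j = 1 ->
  exists2 s : seq I, size s = b &
    sqnorm (g + c *: \sum_(j <- s) (u j - \sum_k w k *: u k)) <=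
    sqnorm g + b%:R * (c ^+ 2 * \sum_k w k * sqnorm (u k)).
Proof.
move=> w0 w1; elim: b => [|b [s sb IH]].
  by exists [::] => //; rewrite big_nil scaler0 addr0 mul0r addr0.
have [j Hj] := maurey_step u (g + c *: \sum_(j <- s) (u j - \sum_k w k *: u k)) c w0 w1.
exists (j :: s); first by rewrite /= sb.
rewrite big_cons scalerDr [c *: _ + _]addrC addrA.
apply: le_trans Hj _; rewrite -natr1 mulrDl mul1r addrA.
by rewrite lerD2r.
Qed.

End Maurey.

Section SparseApproximation.
Context {R : realType} {n M : nat}.
Variables (X : 'M[R]_(n, M)).
Implicit Types (th : 'rV[R]_M) (f : 'rV[R]_n).

Lemma at_design_flin th : at_design X (flin th) = th *m X^T.
Proof. by apply/rowP => i; rewrite !mxE; apply: eq_bigr => j _; rewrite !mxE. Qed.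

Lemma sqnorm_column j : normalized_design X -> sqnorm (row j X^T) <= n%:R.
Proof.
move=> /(_ j); have [n0|n0] := posnP n.
  move=> _; rewrite /sqnorm big1 ?ler0n// => i _; exfalso; by move: (ltn_ord i); rewrite {2}n0.
rewrite ler_pdivrMr ?ltr0n// mul1r => H; apply: le_trans H.
by rewrite le_eqVlt; apply/orP; left; apply/eqP; apply: eq_bigr => i _; rewrite !mxE.
Qed.

(** The coefficients in H are kept.  A column j outside H is drawn with
probability |th j| / S and receives the coefficient S sg(th j) / b, where S is
the l1 norm outside H: the mean is the discarded combination, and every drawn
vector has squared norm at most S^2 n. *)
Lemma sparse_approx th f (H : {set 'I_M}) (b : nat) : normalized_design X -> (0 < b)%N ->
  exists th', (norm0 th' <= #|H| + b)%N /\
    sqnorm (th' *m X^T - f) <=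
    sqnorm (th *m X^T - f) + (\sum_(j | j \notin H) `|th 0 j|) ^+ 2 * n%:R / b%:R.
Proof.
move=> nX b0; set S := \sum_(j | _) _.
have S0 : 0 <= S by apply: sumr_ge0.
have suppH (h : 'rV[R]_M) (s : seq 'I_M) : size s = b ->
    (forall j, h 0 j != 0 -> (j \in H) || (j \in s)) -> (norm0 h <= #|H| + b)%N.
  move=> sb hs; apply: (@leq_trans #|H :|: [set j in s]%SET|).
    by apply/subset_leq_card/fintype.subsetP => j; rewrite !inE; exact: hs.
  apply: leq_trans (leq_card_setU _ _).1 _; rewrite leq_add2l cardsE -sb.
  exact: card_size.
have [Sz|Spos] := eqVneq S 0.
  exists th; split; last by rewrite lerDl Sz expr0n/= !mul0r.
  apply: leq_trans (leq_addr _ _); apply/subset_leq_card/fintype.subsetP => j; rewrite !inE.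
  apply: contraR => jH; move/eqP: Sz; rewrite psumr_eq0// => /allP/(_ j).
  by rewrite mem_index_enum jH /= normr_eq0; exact.
pose w j : R := if j \in H then 0 else `|th 0 j| / S.
pose a j : 'rV[R]_M := (S * Num.sg (th 0 j)) *: delta_mx 0 j.
pose u j : 'rV[R]_n := a j *m X^T.
have w0 j : 0 <= w j by rewrite /w; case: ifP => // _; rewrite divr_ge0.
have w1 : \sum_j w j = 1.
  rewrite (eq_bigr (fun j => if j \notin H then `|th 0 j| / S else 0)).
    by rewrite -big_mkcond -mulr_suml -/S divff.
  by move=> j _; rewrite /w; case: ifP.
have [s sb Hs] := maurey u (th *m X^T - f) b%:R^-1 b w0 w1.
pose thH : 'rV[R]_M := \row_j (if j \in H then th 0 j else 0).
have wu : \sum_k w k *: u k = (th - thH) *m X^T.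
  rewrite /u; under eq_bigr do rewrite scalemxAl.
  rewrite -mulmx_suml; congr (_ *m _); apply/rowP => k; rewrite summxE (bigD1 k)//= big1.
    rewrite addr0 !mxE !eqxx /w mulr1; case: ifP => kH.
      by rewrite mul0r subrr.
    rewrite subr0 [RHS]numEsg; field; exact: Spos.
  by move=> j jk; rewrite !mxE [k == j]eq_sym (negbTE jk) andbF !mulr0.
exists (thH + b%:R^-1 *: \sum_(j <- s) a j); split.
  apply: (suppH _ s sb) => j; rewrite !mxE; case: ifP => //= jH; rewrite add0r.
  apply: contraR => js; rewrite mulf_eq0; apply/orP; right.
  rewrite summxE big_seq big1// => k ks; rewrite !mxE.
  have [jk|_] := eqVneq j k; first by rewrite jk ks in js.
  by rewrite andbF mulr0.
have -> : (thH + b%:R^-1 *: \sum_(j <- s) a j) *m X^T - f =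
   (th *m X^T - f) + b%:R^-1 *: \sum_(j <- s) (u j - \sum_k w k *: u k).
  have bV (v : 'rV[R]_n) : b%:R^-1 *: (v *+ b) = v.
    by rewrite -[v *+ b]scaler_nat scalerA mulVf ?scale1r// pnatr_eq0 -lt0n.
  rewrite wu sumrB big_const_seq count_predT sb iter_addr_0 scalerBr bV.
  rewrite /u -mulmx_suml mulmxDl -scalemxAl mulmxBl opprB.
  have AC (A B C : 'rV[R]_n) : A + B - f = C - f + (B + (A - C)).
    by apply/rowP => k; rewrite !mxE; ring.
  exact: AC.
apply: le_trans Hs _; rewrite lerD2l.
have V : \sum_k w k * sqnorm (u k) <= S ^+ 2 * n%:R.
  apply: (@le_trans _ _ (\sum_k w k * (S ^+ 2 * n%:R))); last by rewrite -mulr_suml w1 mul1r.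
  apply: ler_sum => k _; apply: ler_wpM2l => //.
  rewrite /u /a -scalemxAl -rowE sqnormZ exprMn -mulrA ler_wpM2l ?sqr_ge0//.
  have := sqnorm_column k nX; have := sqnorm_ge0 (row k X^T).
  by case: sgrP => _; rewrite ?expr0n ?expr1n ?sqrrN ?expr1n /= ?mul0r ?mul1r//; lra.
apply: (@le_trans _ _ (b%:R * (b%:R^-1 ^+ 2 * (S ^+ 2 * n%:R)))).
  by do 2 apply: ler_wpM2l => //.
rewrite le_eqVlt; apply/orP; left; apply/eqP; field.
by rewrite pnatr_eq0 -lt0n.
Qed.

Lemma sum_powR_le th (q t : R) : 0 < q -> 0 < t -> Defs.normq q th <= t ->
  \sum_j `|th 0 j| `^ q <= t `^ q.
Proof.
move=> q0 t0 tht.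
have S0 : 0 <= \sum_j `|th 0 j| `^ q by apply: sumr_ge0 => j _; exact: powR_ge0.
have := ge0_ler_powR (ltW q0) _ _ tht; rewrite -powRrM mulVf ?gt_eqF// powRr1//.
by apply; rewrite nnegrE ?powR_ge0// ltW.
Qed.

Lemma coord_le th (q t : R) j : 0 < q -> 0 < t -> Defs.normq q th <= t -> `|th 0 j| <= t.
Proof.
move=> q0 t0 tht; have qV : q * q^-1 = 1 by rewrite divff// gt_eqF.
rewrite -[leLHS]powRr1// -[leRHS]powRr1 ?(ltW t0)// -qV !powRrM.
apply: ge0_ler_powR; rewrite ?nnegrE ?powR_ge0 ?invr_ge0 ?(ltW q0)//.
apply: le_trans (sum_powR_le q0 t0 tht); rewrite (bigD1 j)//= lerDl.
by apply: sumr_ge0 => k _; exact: powR_ge0.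
Qed.

(** Markov's inequality for the q-th powers. *)
Lemma card_gt_threshold th (q t : R) (a : nat) : 0 < q -> 0 < t -> (0 < a)%N ->
  Defs.normq q th <= t ->
  (#|[set j : 'I_M | (t * a%:R `^ (- q^-1) < `|th 0 j|)%R]%SET| <= a)%N.
Proof.
move=> q0 t0 a0 tht.
have sq := sum_powR_le q0 t0 tht.
set H := [set j | _]%SET.
have a0' : 0 < a%:R :> R by rewrite ltr0n.
have Hle : #|H|%:R * (t `^ q / a%:R) <= t `^ q.
  apply: le_trans sq; rewrite (bigID (mem H))/=.
  apply: (@le_trans _ _ (\sum_(j in H) `|th 0 j| `^ q)); last first.
    by rewrite lerDl; apply: sumr_ge0 => j _; exact: powR_ge0.
  rewrite mulrC mulr_natr -sumr_const; apply: ler_sum => j; rewrite inE => /ltW jH.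
  have e : t `^ q / a%:R = (t * a%:R `^ (- q^-1)) `^ q.
    by rewrite powRM ?powR_ge0 ?(ltW t0)// -powRrM mulNr mulVf ?gt_eqF// powR_inv1// ltW.
  rewrite e; apply: ge0_ler_powR jH; rewrite ?nnegrE ?(ltW q0)//.
  by rewrite mulr_ge0 ?powR_ge0// ltW.
have tq : 0 < t `^ q by exact: powR_gt0.
move: Hle; rewrite mulrCA -ler_pdivlMl// mulVf ?gt_eqF// ler_pdivrMr// mul1r ler_nat//.
Qed.

(** Below the level v, |x| is at most v^(1-q) |x|^q. *)
Lemma sum_small_le th (q t v : R) (H : {set 'I_M}) : 0 < q -> q <= 1 -> 0 < t -> 0 < v ->
  Defs.normq q th <= t ->
  (forall j, j \notin H -> `|th 0 j| <= v) ->
  \sum_(j | j \notin H) `|th 0 j| <= v `^ (1 - q) * t `^ q.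
Proof.
move=> q0 q1 t0 v0 tht Hv.
have sq := sum_powR_le q0 t0 tht.
apply: (@le_trans _ _ (\sum_(j | j \notin H) v `^ (1 - q) * `|th 0 j| `^ q)).
  apply: ler_sum => j jH; have [->|th0] := eqVneq (th 0 j) 0.
    by rewrite normr0 mulr_ge0 ?powR_ge0.
  have th1 : 0 < `|th 0 j| by rewrite normr_gt0.
  rewrite -[leLHS](@powRr1 _ `|th 0 j|)// -{1}(subrK q 1) powRD; last first.
    by rewrite (gt_eqF th1) implybT.
  apply: ler_wpM2r; first exact: powR_ge0.
  apply: ge0_ler_powR; rewrite ?nnegrE ?subr_ge0 ?(ltW v0)//.
  exact: Hv.
rewrite -mulr_sumr; apply: ler_wpM2l; first exact: powR_ge0.
apply: le_trans sq; rewrite [leRHS](bigID (fun j => j \notin H))/= lerDl.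
by apply: sumr_ge0 => j _; exact: powR_ge0.
Qed.

End SparseApproximation.

(** * The price of a model *)

Section SparsityPrice.
Context {R : realType}.
Implicit Types (M k : nat).

(** The order of the logarithm of the number of models of size k; it also
dominates k and 1 + ln M. *)
Definition sparsity_price M k : R := k%:R * (1 + ln (M%:R / k%:R)).

Lemma ln_le_pred (x : R) : 0 < x -> ln x <= x - 1.
Proof.
by move=> x0; rewrite -[X in ln X](addrNK 1) addrC le_ln1Dx// ltrBDr addNr.
Qed.

(** Binomial coefficients are at most (e M / k)^k, as k^k / k! <= e^k. *)
Lemma ln_bin_le M k : (0 < k)%N -> (k <= M)%N -> ln ('C(M, k)%:R : R) <= sparsity_price M k.
Proof.
move=> k0 kM; have M0 := leq_trans k0 kM.
have k0' : 0 < k%:R :> R by rewrite ltr0n.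
have M0' : 0 < M%:R :> R by rewrite ltr0n.
have kf : (0 : R) < (k`!)%:R by rewrite ltr0n fact_gt0.
have e0 : 0 < expR 1 * (M%:R / k%:R) :> R by rewrite mulr_gt0 ?expR_gt0 ?divr_gt0.
have -> : sparsity_price M k = ln ((expR 1 * (M%:R / k%:R)) ^+ k).
  by rewrite lnXn// lnM ?posrE ?expR_gt0 ?divr_gt0// expRK -[RHS]mulr_natl.
rewrite ler_ln ?posrE ?ltr0n ?bin_gt0 ?exprn_gt0//.
have ffact : (M ^_ k <= M ^ k)%N.
  elim: k {k0 kM k0' kf e0} => [|k IH] //; rewrite ffactnSr expnSr.
  by apply: leq_mul => //; exact: leq_subr.
apply: (@le_trans _ _ (M%:R ^+ k / (k`!)%:R)).
  by rewrite ler_pdivlMr// -natrM -natrX ler_nat bin_ffact.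
rewrite exprMn expr_div_n mulrCA; apply: ler_wpM2l; first by rewrite exprn_ge0// ltW.
rewrite ler_pdivlMr ?exprn_gt0// mulrC -expRM_natl mulr1.
have := @expR_ge1Dxn R k%:R k.-1 (ltW k0'); rewrite prednK//; lra.
Qed.

Lemma sparsity_price_ge M k : (0 < k)%N -> (k <= M)%N ->
  1 + ln (M%:R : R) <= sparsity_price M k.
Proof.
move=> k0 kM; have M0 := leq_trans k0 kM.
have k0' : 0 < k%:R :> R by rewrite ltr0n.
have M0' : 0 < M%:R :> R by rewrite ltr0n.
have k1 : (1 : R) <= k%:R by rewrite ler1n.
rewrite /sparsity_price ln_div ?posrE//.
have lk := ln_le_pred k0'.
have lkM : ln (k%:R : R) <= ln (M%:R) by rewrite ler_ln ?posrE// ler_nat.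
nra.
Qed.

Lemma sparsity_price_ge_size M k : (0 < k)%N -> (k <= M)%N -> k%:R <= sparsity_price M k.
Proof.
move=> k0 kM; have k0' : 0 < k%:R :> R by rewrite ltr0n.
rewrite /sparsity_price ler_peMr ?ler0n// lerDl ln_ge0// ler_pdivlMr// mul1r ler_nat//.
Qed.

End SparsityPrice.

Lemma exists_superset (T : finType) (A : {set T}) k : (#|A| <= k <= #|T|)%N ->
  exists2 B : {set T}, A \subset B & #|B| = k.
Proof.
move=> /andP[]; elim: k => [|k IH].
  by rewrite leqn0 => /eqP A0 _; exists A.
rewrite leq_eqVlt => /predU1P[<- _|]; first by exists A.
rewrite ltnS => Ak kT; have [B AB Bk] := IH Ak (ltnW kT).
have /card_gt0P[x] : (0 < #|~: B|)%N by rewrite cardsCs finset.setCK Bk subn_gt0.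
rewrite finset.in_setC => xB; exists (x |: B)%SET; last by rewrite cardsU1 xB Bk.
by apply: fintype.subset_trans AB _; exact: subsetU1.
Qed.

Section RiskBounds.
Context d (T : measurableType d) (R : realType) (P : probability T R).
Variables (n M : nat) (eps : 'I_n -> {RV P >-> R}) (sigma : R).
Variables (X : 'M[R]_(n, M)) (f0 : 'rV[R]_M -> R).
Hypotheses (n0 : (0 < n)%N) (s0 : 0 < sigma) (nrm : iid_normal eps sigma).
Let f := at_design X f0.
Local Notation risk := (risk_MLS eps sigma X f0).

(** The rank term, plus 4 ln (1 / 0.05) for the three models of prior 0.05. *)
Definition flat_price : R := 1 + 4 * ln 20%:R.

Lemma ler_normn2 (u v : 'rV[R]_n) : sqnorm u <= sqnorm v -> normn2 u <= normn2 v.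
Proof. by move=> uv; rewrite /normn2 ler_pM2r// invr_gt0 ltr0n. Qed.

Lemma ln20_ge0 : (0 : R) <= ln 20%:R.
Proof. by rewrite ln_ge0// ler1n. Qed.

Lemma flat_price_ge0 : 0 <= flat_price.
Proof. by rewrite addr_ge0// mulr_ge0// ln20_ge0. Qed.

Lemma flat_priceM x : flat_price * x = x + 4 * ln 20%:R * x.
Proof. by rewrite /flat_price [LHS]mulrDl mul1r. Qed.

Lemma prior_flatV : (5%:R / 100%:R : R)^-1 = 20%:R.
Proof. by field. Qed.

Lemma risk_full_le th : (1 <= model_rank X FullModel)%N ->
  (risk <= (normn2 (th *m X^T - f)
     + flat_price * (sigma ^+ 2 * (model_rank X FullModel)%:R / n%:R))%:E)%E.
Proof.
move=> r1; apply: (le_trans (@risk_le_model _ _ _ _ _ _ eps sigma X f0 n0 s0 nrm FullModel I)).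
rewrite lee_fin -addrA; apply: lerD.
  apply: ler_normn2; apply: orthoproj_best; first exact: colproj_orthoproj.
  exact: colproj_id.
rewrite /= prior_flatV flat_priceM lerD2l [leRHS]mulrA ler_pM2r ?invr_gt0 ?ltr0n//.
rewrite [leRHS](_ : _ = 4 * sigma ^+ 2 * ln 20%:R * (model_rank X FullModel)%:R); last by ring.
by rewrite ler_peMr ?ler1n//; apply: mulr_ge0 ln20_ge0; apply: mulr_ge0 => //; exact: sqr_ge0.
Qed.

Lemma risk_null_le :
  (risk <= (normn2 (model_fit X NullModel f - f) + flat_price * sigma ^+ 2 / n%:R)%:E)%E.
Proof.
apply: (le_trans (@risk_le_model _ _ _ _ _ _ eps sigma X f0 n0 s0 nrm NullModel I)).
rewrite lee_fin -addrA lerD2l /= prior_flatV -mulrDl ler_pM2r ?invr_gt0 ?ltr0n//.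
rewrite flat_priceM [4 * ln _ * _]mulrAC lerD2r ler_piMr ?sqr_ge0//.
by rewrite -[leRHS]/(1%:R) ler_nat; exact: rank_leq_col.
Qed.

Lemma risk_proj_le : (risk <= (flat_price * sigma ^+ 2)%:E)%E.
Proof.
apply: (le_trans (@risk_le_model _ _ _ _ _ _ eps sigma X f0 n0 s0 nrm ProjModel I)).
have -> : model_fit X ProjModel (at_design X f0) = at_design X f0.
  by rewrite /model_fit /= -[X in X *m _]mulmx1 -{1}trmx1 colproj_id trmx1 mulmx1.
rewrite lee_fin subrr /normn2 -/(sqnorm _) sqnorm_dot /dot mul0mx mxE mul0r add0r.
rewrite /= prior_flatV flat_priceM; apply: lerD.
  rewrite ler_pdivrMr ?ltr0n// ler_wpM2l ?sqr_ge0// ler_nat.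
  exact: rank_leq_row.
rewrite [4 * ln _ * _]mulrAC ler_pdivrMr ?ltr0n// ler_peMr ?ler1n//.
by apply: mulr_ge0 ln20_ge0; apply: mulr_ge0 => //; exact: sqr_ge0.
Qed.

Lemma model_fit_sub_le (U : {set 'I_M}) (th : 'rV[R]_M) :
  (forall j, th 0 j != 0 -> j \in U) ->
  sqnorm (model_fit X (SubModel U) f - f) <= sqnorm (th *m X^T - f).
Proof.
move=> thU; apply: orthoproj_best; first exact: colproj_orthoproj.
have -> : th *m X^T = (\row_k th 0 (enum_val (k : 'I_#|U|)))
    *m (model_design X (SubModel U))^T.
  apply/rowP => i; rewrite !mxE (bigID (mem U))/= [X in _ + X]big1 ?addr0; last first.
    by move=> j jU; have [->|/thU] := eqVneq (th 0 j) 0; [rewrite mul0r|rewrite (negbTE jU)].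
  rewrite big_enum_val; apply: eq_bigr => k _; by rewrite !mxE.
exact: colproj_id.
Qed.

(** The constant is 1 for the rank and 4 times 3 for the logarithm of the prior:
ln M for the number of sizes, the binomial coefficient, and ln (1 / 0.85) <= 1
are each at most [sparsity_price]. *)
Lemma risk_sparse_le th k : (1 <= k <= minn (M - 1) n)%N -> (norm0 th <= k)%N ->
  (risk <= (normn2 (th *m X^T - f) + 13%:R * (sigma ^+ 2 * sparsity_price M k / n%:R))%:E)%E.
Proof.
move=> k1 thk; have /andP[k0] := k1; rewrite leq_min => /andP[kM kn].
have kM' : (k <= M)%N by apply: leq_trans kM (leq_subr _ _).
have [|U AU Uk] := @exists_superset _ [set j | th 0 j != 0]%SET k.
  by rewrite card_ord kM' andbT cardsE.
have thU j : th 0 j != 0 -> j \in U.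
  by move=> thj; apply: (fintype.subsetP AU); rewrite finset.inE.
have UG : in_Gamma n (SubModel U) by rewrite /= Uk.
apply: (le_trans (@risk_le_model _ _ _ _ _ _ eps sigma X f0 n0 s0 nrm _ UG)).
rewrite lee_fin -addrA; apply: lerD; first exact: ler_normn2 (model_fit_sub_le thU).
rewrite -mulrDl [leRHS]mulrA ler_pM2r ?invr_gt0 ?ltr0n//.
set L := sparsity_price M k.
have rk : (model_rank X (SubModel U))%:R <= L.
  apply: le_trans (sparsity_price_ge_size k0 kM').
  by rewrite ler_nat -Uk; exact: rank_leq_col.
have M0 : (0 < M)%N by exact: leq_trans k0 kM'.
have mm0 : (0 < minn (M - 1) n)%N by case/andP: k1 => ? ?; exact: leq_trans k0 _.
have lnp : ln (prior R n (SubModel U))^-1 <= 3 * L.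
  have -> : (prior R n (SubModel U))^-1 =
      (minn (M - 1) n)%:R * 'C(M, k)%:R * (1 + 15%:R / 85%:R) :> R.
    rewrite /prior Uk; field; rewrite !pnatr_eq0 -!lt0n mm0 bin_gt0 kM'//.
  have C0 : (0 : R) < 'C(M, k)%:R by rewrite ltr0n bin_gt0.
  have m0 : (0 : R) < (minn (M - 1) n)%:R by rewrite ltr0n.
  have d0 : (0 : R) < 15%:R / 85%:R by rewrite divr_gt0.
  rewrite !lnM ?posrE ?mulr_gt0 ?addr_gt0//.
  have l1 : ln (1 + 15%:R / 85%:R : R) <= 1.
    apply: le_trans (le_ln1Dx _) _; first by rewrite (lt_trans _ d0)// ltrN10.
    by rewrite ler_pdivrMr// mul1r ler_nat.
  have l2 : ln ((minn (M - 1) n)%:R : R) <= ln (M%:R).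
    rewrite ler_ln ?posrE ?ltr0n// ler_nat; apply: leq_trans (geq_minl _ _) (leq_subr _ _).
  have l3 := @ln_bin_le R M k k0 kM'.
  have l4 := @sparsity_price_ge R M k k0 kM'.
  have l5 : (0 : R) <= ln M%:R by rewrite ln_ge0// ler1n.
  rewrite -/L in l3 l4; lra.
have := sqr_ge0 sigma; nra.
Qed.

(** The infimum can be taken because the approximation error has the factor one;
the risk is finite by [risk_proj_le]. *)
Lemma risk_le_dn2 (F : set ('rV[R]_M -> R)) (c : R) : F !=set0 ->
  (forall g, F g -> (risk <= (normn2 (at_design X g - f) + c)%:E)%E) ->
  (risk <= (dn2 X f0 F + c)%:E)%E.
Proof.
move=> [g0 Fg0] H.
have r0 : (0 <= risk)%E.
  rewrite /risk_MLS unlock; apply: integral_ge0 => w _.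
  by rewrite lee_fin divr_ge0// sqnorm_ge0.
have rfin : risk \is a fin_num.
  by rewrite ge0_fin_numE// (le_lt_trans risk_proj_le)// ltry.
rewrite -(fineK rfin) lee_fin -lerBlDr; apply: lb_le_inf.
  by exists (normn2 (at_design X g0 - f)); exists g0.
move=> _ [g Fg <-]; have := H g Fg; rewrite -{1}(fineK rfin) lee_fin; lra.
Qed.

End RiskBounds.

(** * Effective model size and rates *)

Section CeilNat.
Context {R : realType}.

Lemma ceil_nat_bounds (x : R) : 0 < x ->
  x <= (`|Num.ceil x|%N)%:R /\ (`|Num.ceil x|%N)%:R < x + 1.
Proof.
move=> x0; have c0 : 0 <= Num.ceil x by rewrite ltW// ceil_gt0.
have -> : (`|Num.ceil x|%N)%:R = (Num.ceil x)%:~R :> R.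
  by rewrite -[RHS]/((Num.ceil x)%:~R) -{2}(gez0_abs c0).
split; first exact: ceil_ge.
by have := ceilB1_lt x; rewrite intrD rmorphN/= ltrBlDr.
Qed.

Lemma ceil_nat_gt0 (x : R) : 0 < x -> (0 < `|Num.ceil x|)%N.
Proof. by move=> x0; rewrite absz_gt0 gt_eqF// ceil_gt0. Qed.

Lemma ceil_nat_le (x : R) (m : nat) : 0 < x -> x <= m%:R -> (`|Num.ceil x| <= m)%N.
Proof.
move=> x0 xm; rewrite -ltnS -(ltr_nat R); have [_ lt] := ceil_nat_bounds x0.
by apply: lt_le_trans lt _; rewrite -natr1 lerD2r.
Qed.

End CeilNat.

Lemma ln_sqr {R : realType} (y : R) : 0 < y -> ln (y ^+ 2) = 2 * ln y.
Proof. by move=> y0; rewrite lnXn// mulr_natl. Qed.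

Section EffectiveSizeRate.
Context {R : realType}.
Variables (n M : nat) (sigma q t : R).
Hypotheses (n0 : (0 < n)%N) (M0 : (0 < M)%N) (s0 : 0 < sigma) (t0 : 0 < t).
Hypotheses (q0 : 0 < q) (q1 : q <= 1).

Local Notation S := (snr n sigma q t).
Local Notation mu := (m_upper n M sigma q t).
Local Notation ms := (m_lower n M sigma q t).
Let L : R := ln (M%:R / mu%:R).
Let x : R := mu%:R / (1 + L) `^ (q / 2).

Let n0' : 0 < n%:R :> R. Proof. by rewrite ltr0n. Qed.
Let M0' : 0 < M%:R :> R. Proof. by rewrite ltr0n. Qed.

Let base0 : 0 < n%:R * t ^+ 2 * tau sigma.
Proof. by rewrite /tau !mulr_gt0 ?invr_gt0 ?exprn_gt0. Qed.

Lemma snr_gt0 : 0 < S.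
Proof. exact: powR_gt0. Qed.

Lemma ln_snr : ln S = q / 2 * (ln n%:R + 2 * ln t - 2 * ln sigma).
Proof.
rewrite /snr ln_powR; congr (_ * _).
rewrite /tau !lnM ?posrE ?mulr_gt0 ?invr_gt0 ?exprn_gt0//.
by rewrite lnV ?posrE ?exprn_gt0// ln_sqr//; ring.
Qed.

(** In units of sigma^2 / n the rate only involves [snr]. *)
Lemma lq_rateE (l : R) : 0 <= l ->
  lq_rate n sigma q t l = sigma ^+ 2 / n%:R * (S * (1 + l) `^ (1 - q / 2)).
Proof.
move=> l0; have l1 : 0 < 1 + l by rewrite ltr_pwDl.
apply: ln_inj; rewrite ?posrE /lq_rate.
- by rewrite !mulr_gt0// powR_gt0// ?divr_gt0.
- by rewrite !mulr_gt0 ?exprn_gt0 ?invr_gt0 ?snr_gt0 ?powR_gt0.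
rewrite !lnM ?posrE ?mulr_gt0 ?powR_gt0 ?divr_gt0 ?invr_gt0 ?exprn_gt0 ?snr_gt0//.
rewrite ln_snr !ln_powR lnM ?posrE ?invr_gt0// lnV ?posrE// ?ln_sqr//.
1: by field.
all: by rewrite mulr_gt0 ?exprn_gt0.
Qed.

Lemma m_upper_gt0 : (0 < mu)%N.
Proof. by rewrite /m_upper !leq_min ceil_nat_gt0 ?snr_gt0// M0 n0. Qed.

Lemma m_upper_le : (mu <= minn M n)%N.
Proof. exact: geq_minr. Qed.

Let mu0 : 0 < mu%:R :> R. Proof. by rewrite ltr0n m_upper_gt0. Qed.

Let L0 : 0 <= L.
Proof.
rewrite ln_ge0// ler_pdivlMr// mul1r ler_nat.
exact: leq_trans m_upper_le (geq_minl _ _).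
Qed.

Let L1 : 0 < 1 + L. Proof. by rewrite ltr_pwDl. Qed.

Let x0 : 0 < x. Proof. by rewrite divr_gt0// powR_gt0. Qed.

Let x_le : x <= mu%:R.
Proof.
rewrite ler_pdivrMr ?powR_gt0// ler_peMr ?ler0n//.
by rewrite -[leLHS](powRr0 (1 + L)) ler_powR// ?lerDl// divr_ge0 ?ltW.
Qed.

Lemma m_lower_le_upper : (ms <= mu)%N.
Proof. by rewrite /m_lower; case: ifP => // _; exact: ceil_nat_le. Qed.

Lemma snr_saturated : mu = minn M n -> (minn M n)%:R < S + 1.
Proof.
move=> e; have [_] := ceil_nat_bounds snr_gt0; apply: le_lt_trans.
by rewrite ler_nat -{1}e geq_minl.
Qed.

Lemma m_upper_unsaturated : (mu < minn M n)%N ->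
  S <= mu%:R /\ mu%:R < S + 1.
Proof.
move=> lt; have -> : mu = `|Num.ceil S|%N; last exact: ceil_nat_bounds snr_gt0.
by move: lt; rewrite /m_upper gtn_min ltnn orbF => /ltnW/minn_idPl.
Qed.

Lemma m_lower_unsaturated : (mu < minn M n)%N -> x <= ms%:R /\ ms%:R < x + 1.
Proof. by move=> lt; rewrite /m_lower ltn_eqF//; exact: ceil_nat_bounds. Qed.

Let ln_x : ln x = ln (mu%:R) - q / 2 * ln (1 + L).
Proof. by rewrite lnM ?posrE ?invr_gt0 ?powR_gt0// lnV ?posrE ?powR_gt0// ln_powR. Qed.

(** [m_lower] = 1 forces snr <= (1 + L)^(q/2), and snr^(2/q) is n t^2 / sigma^2. *)
Lemma one_term_rate : (mu < minn M n)%N -> ms = 1%N ->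
  t ^+ 2 <= sigma ^+ 2 / n%:R * (1 + ln M%:R).
Proof.
move=> lt ms1; have [Smu _] := m_upper_unsaturated lt.
have [xms _] := m_lower_unsaturated lt; rewrite ms1 in xms.
have lM : 0 <= ln (M%:R : R) by rewrite ln_ge0// ler1n.
rewrite -ler_ln ?posrE ?mulr_gt0 ?exprn_gt0 ?invr_gt0// ?ltr_pwDl//.
rewrite !lnM ?posrE ?mulr_gt0 ?exprn_gt0 ?invr_gt0// ?ltr_pwDl//.
rewrite lnV ?posrE//.
have lx : ln x <= 0 by rewrite ln_le0.
have lS : ln S <= ln (mu%:R) by rewrite ler_ln ?posrE ?snr_gt0.
have LM : ln (1 + L) <= ln (1 + ln M%:R).
  rewrite ler_ln ?posrE// ?ltr_pwDl// lerD2l ler_ln ?posrE ?divr_gt0//.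
  by rewrite ler_pdivrMr// ler_peMr ?ler0n// ler1n m_upper_gt0.
have : q / 2 * (ln n%:R + 2 * ln t - 2 * ln sigma) <= q / 2 * ln (1 + L).
  by rewrite -ln_snr; move: lx; rewrite ln_x; lra.
rewrite ler_pM2l ?divr_gt0//; lra.
Qed.

Lemma ln_ratio_le : (mu < minn M n)%N -> L <= ln (M%:R / S).
Proof.
move=> lt; have [Smu _] := m_upper_unsaturated lt.
rewrite ler_ln ?posrE ?divr_gt0 ?snr_gt0// ler_pM2l// lef_pV2 ?posrE ?snr_gt0//.
Qed.

Lemma ln_snr_ge0 : (mu < minn M n)%N -> 0 <= ln (M%:R / S).
Proof. by move=> lt; exact: le_trans L0 (ln_ratio_le lt). Qed.

Lemma rate_factor_le : (mu < minn M n)%N ->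
  (1 + L) `^ (1 - q / 2) <= (1 + ln (M%:R / S)) `^ (1 - q / 2).
Proof.
move=> lt; have Ll := ln_ratio_le lt.
have l1 : 0 < 1 + ln (M%:R / S) by apply: lt_le_trans L1 _; rewrite lerD2l.
apply: ge0_ler_powR; rewrite ?nnegrE ?(ltW L1) ?(ltW l1) ?lerD2l//.
by have := q1; lra.
Qed.

Lemma snr_gt1 : (mu < minn M n)%N -> (1 < ms)%N -> 1 < S.
Proof.
move=> lt ms1; have [_ muS] := m_upper_unsaturated lt.
have : (2 : R) <= mu%:R by rewrite ler_nat; exact: leq_trans ms1 m_lower_le_upper.
lra.
Qed.

(** [m_lower] is x rounded up, and x > 1, so it is at most 2 x; moreover
1 + ln (M / x) <= 2 (1 + L).  The last factor 2 comes from mu <= 2 snr. *)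
Lemma sparsity_price_m_lower : (mu < minn M n)%N -> (1 < ms)%N ->
  sparsity_price M ms <= 8 * (S * (1 + L) `^ (1 - q / 2)).
Proof.
move=> lt ms1; have [Smu muS] := m_upper_unsaturated lt.
have [xms msx] := m_lower_unsaturated lt; have S1 := snr_gt1 lt ms1.
have ms2 : (2 : R) <= ms%:R by rewrite ler_nat.
have msp : 0 < ms%:R :> R by apply: lt_le_trans ms2.
have lL : ln (1 + L) <= L by rewrite le_ln1Dx// (lt_le_trans _ L0).
have lms : 1 + ln (M%:R / ms%:R : R) <= 2 * (1 + L).
  have : ln (M%:R / ms%:R : R) <= ln (M%:R / x).
    by rewrite ler_ln ?posrE ?(divr_gt0 M0' msp) ?(divr_gt0 M0' x0)// ler_pM2l// lef_pV2 ?posrE.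
  have -> : ln (M%:R / x) = L + q / 2 * ln (1 + L).
    rewrite lnM ?posrE ?invr_gt0// lnV ?posrE// ln_x /L.
    by rewrite lnM ?posrE ?invr_gt0// lnV ?posrE//; ring.
  have : 0 <= ln (1 + L) by rewrite ln_ge0// lerDl.
  have := q1; have := q0; have := L0; nra.
have -> : S * (1 + L) `^ (1 - q / 2) = S / (1 + L) `^ (q / 2) * (1 + L).
  rewrite powRD; last by rewrite (gt_eqF L1) implybT.
  by rewrite powRr1 ?(ltW L1)// powRN; ring.
apply: (@le_trans _ _ ((2 * x) * (2 * (1 + L)))).
  apply: ler_pM => //.
    rewrite addr_ge0// ln_ge0// ler_pdivlMr// mul1r ler_nat.
    exact: leq_trans m_lower_le_upper (leq_trans m_upper_le (geq_minl _ _)).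
  have x1 : 1 < x by lra.
  lra.
have p0 : 0 < ((1 + L) `^ (q / 2))^-1 by rewrite invr_gt0 powR_gt0.
rewrite /x; have : mu%:R / (1 + L) `^ (q / 2) <= 2 * (S / (1 + L) `^ (q / 2)).
  by rewrite mulrA ler_pM2r//; lra.
have := L1; nra.
Qed.

(** The left side is the sampling variance when a coefficients are kept and b
columns are drawn.  In logarithms the inequality is linear: with r = 1 / q it
follows from ln a, ln b >= ln x - ln 3 and ln snr <= ln mu, with the weights
2 (r - 1), 1 and 2 r - 1. *)
Lemma maurey_rate a b : (mu < minn M n)%N -> (1 < ms)%N ->
  (0 < a)%N -> (0 < b)%N -> (ms <= 3 * a)%N -> (ms <= 3 * b)%N ->
  ((t * a%:R `^ (- q^-1)) `^ (1 - q) * t `^ q) ^+ 2 / b%:R <=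
  3%:R `^ (2 / q - 1) * (sigma ^+ 2 / n%:R * (S * (1 + L) `^ (1 - q / 2))).
Proof.
move=> lt ms1 a0 b0 msa msb.
have [Smu _] := m_upper_unsaturated lt; have [xms _] := m_lower_unsaturated lt.
have a0' : 0 < a%:R :> R by rewrite ltr0n.
have b0' : 0 < b%:R :> R by rewrite ltr0n.
have ta0 : 0 < t * a%:R `^ (- q^-1) by rewrite mulr_gt0 ?powR_gt0.
have v0 : 0 < (t * a%:R `^ (- q^-1)) `^ (1 - q) * t `^ q by rewrite mulr_gt0 ?powR_gt0.
rewrite -ler_ln ?posrE; last 2 first.
- by rewrite divr_gt0 ?exprn_gt0.
- by rewrite !mulr_gt0 ?powR_gt0 ?exprn_gt0 ?invr_gt0 ?snr_gt0.
have s20 : 0 < sigma ^+ 2 by rewrite exprn_gt0.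
have Sy0 : 0 < S * (1 + L) `^ (1 - q / 2) by rewrite mulr_gt0 ?snr_gt0 ?powR_gt0.
rewrite ln_div ?posrE ?exprn_gt0// ln_sqr// [ln (_ * t `^ q)]lnM ?posrE ?powR_gt0//.
rewrite [ln (_ `^ (1 - q))]ln_powR [ln (t * _)]lnM ?posrE ?powR_gt0//.
rewrite [X in _ <= X]lnM ?posrE ?powR_gt0 ?mulr_gt0 ?invr_gt0//.
rewrite [ln (sigma ^+ 2 / _ * _)]lnM ?posrE ?divr_gt0// [ln (sigma ^+ 2 / _)]ln_div ?posrE//.
rewrite [ln (S * _)]lnM ?posrE ?powR_gt0 ?snr_gt0// ln_sqr//.
rewrite [ln (3%:R `^ _)]ln_powR [ln ((1 + L) `^ _)]ln_powR.
rewrite [ln (a%:R `^ _)]ln_powR [ln (t `^ _)]ln_powR.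
2: exact: snr_gt0.
2: exact: powR_gt0.
have x3 m : (0 < m)%N -> (ms <= 3 * m)%N -> ln x - ln 3%:R <= ln m%:R.
  move=> m0 msm; rewrite lerBlDr -lnM ?posrE ?ltr0n// ler_ln ?posrE//; last first.
    by rewrite mulr_gt0 ?ltr0n.
  by apply: le_trans xms _; rewrite -natrM ler_nat mulnC.
have la := x3 a a0 msa; have lb := x3 b b0 msb.
have lS : ln S <= ln (mu%:R) by rewrite ler_ln ?posrE ?snr_gt0.
rewrite ln_x in la lb.
have pq : q * q^-1 = 1 by rewrite divff// gt_eqF.
set T := ln n%:R + 2 * ln t - 2 * ln sigma.
have TS : T = 2 * q^-1 * ln S by rewrite ln_snr -/T; field; rewrite gt_eqF.
set r := q^-1 in la lb pq TS *.
have r1 : 1 <= r by rewrite /r invf_ge1.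
set z := ln mu%:R in la lb lS; set y := ln (1 + L) in la lb *.
have Hlna : (r - 1) * (z - q / 2 * y - ln 3%:R) <= (r - 1) * ln a%:R.
  by rewrite ler_wpM2l// subr_ge0.
have HS : (2 * r - 1) * ln S <= (2 * r - 1) * z by rewrite ler_wpM2l//; lra.
have e1 : 2 * ((1 - q) * (ln t + - r * ln a%:R) + q * ln t) = 2 * ln t - 2 * ((r - 1) * ln a%:R).
  have : (1 - q) * r = r - 1 by rewrite mulrBl pq mul1r.
  move=> e; transitivity (2 * ln t - 2 * ((1 - q) * r) * ln a%:R); first by ring.
  by rewrite e; ring.
have e2 : (r - 1) * (z - q / 2 * y - ln 3%:R) = (r - 1) * z - (1 - q) / 2 * y - (r - 1) * ln 3%:R.
  have -> : (1 - q) / 2 * y = (r * q - q) / 2 * y by rewrite [r * q]mulrC pq.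
  by ring.
rewrite e1; rewrite e2 in Hlna.
have e3 : 2 * ln t = 2 * r * ln S - ln n%:R + 2 * ln sigma by rewrite -TS /T; ring.
rewrite e3; lra.
Qed.

End EffectiveSizeRate.

(** * The theorem *)

Lemma lt_minn_pred m M n : (m < minn M n)%N -> (m <= minn (M - 1) n)%N.
Proof.
rewrite !leq_min => /andP[mM mn].
by rewrite (ltnW mn) andbT subn1 -ltnS prednK// (leq_ltn_trans _ mM).
Qed.

Section LqRisk.
Context d (T : measurableType d) (R : realType) (P : probability T R).
Variables (n M : nat) (eps : 'I_n -> {RV P >-> R}) (sigma : R).
Variables (X : 'M[R]_(n, M)) (f0 : 'rV[R]_M -> R).
Hypotheses (n0 : (0 < n)%N) (M0 : (0 < M)%N) (s0 : 0 < sigma).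
Hypotheses (nrm : iid_normal eps sigma) (nX : normalized_design X).
Hypothesis r1 : (1 <= model_rank X FullModel)%N.
Let f := at_design X f0.
Local Notation risk := (risk_MLS eps sigma X f0).
Local Notation full := (sigma ^+ 2 * (model_rank X FullModel)%:R / n%:R).

(** Twice [flat_price] covers the full model when the effective size is
saturated, the power of 3 the sampling variance, and 104 = 13 * 8 the price of
a model of size [m_lower]. *)
Definition lq_price (q : R) : R := 2 * flat_price R + 3%:R `^ (2 / q - 1) + 104%:R.

Lemma risk_maurey_le (th : 'rV[R]_M) (H : {set 'I_M}) k b e : (0 < b)%N ->
  (#|H| + b <= k <= minn (M - 1) n)%N ->
  (\sum_(j | j \notin H) `|th 0 j|) ^+ 2 / b%:R <= e ->
  (risk <= (normn2 (th *m X^T - f) + (e + 13%:R * (sigma ^+ 2 * sparsity_price M k / n%:R)))%:E)%E.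
Proof.
move=> b0 /andP[Hbk kmin] He; have [th' [th'k th'le]] := sparse_approx th f H nX b0.
have k0 : (0 < k)%N by apply: leq_trans Hbk; rewrite addn_gt0 b0 orbT.
apply: (le_trans (risk_sparse_le X f0 n0 s0 nrm (k := k) (th := th') _ _)).
- by rewrite k0.
- exact: leq_trans th'k Hbk.
rewrite lee_fin addrA lerD2r /normn2 ler_pdivrMr ?ltr0n// mulrDl divfK ?pnatr_eq0 -?lt0n//.
apply: (le_trans th'le); rewrite lerD2l.
have -> : forall s : R, s ^+ 2 * n%:R / b%:R = s ^+ 2 / b%:R * n%:R by move=> s; rewrite mulrAC.
by rewrite ler_wpM2r.
Qed.

Lemma flat_le_lq_price q : flat_price R <= lq_price q.
Proof.
have := flat_price_ge0 R; have := powR_ge0 (3%:R : R) (2 / q - 1).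
rewrite /lq_price; lra.
Qed.

Lemma full_ge0 : 0 <= full.
Proof. by rewrite divr_ge0// mulr_ge0 ?sqr_ge0. Qed.

Lemma rank_le_minn : (model_rank X FullModel <= minn M n)%N.
Proof. by rewrite leq_min rank_leq_col rank_leq_row. Qed.

Lemma risk_full_lq (th : 'rV[R]_M) q :
  (risk <= (normn2 (th *m X^T - f) + lq_price q * full)%:E)%E.
Proof.
apply: (le_trans (risk_full_le f0 n0 s0 nrm th r1)).
by rewrite lee_fin lerD2l ler_wpM2r ?full_ge0// flat_le_lq_price.
Qed.

Lemma risk_le_min (c B u v : R) :
  (risk <= (c + B * u)%:E)%E -> (risk <= (c + B * v)%:E)%E ->
  (risk <= (c + B * Num.min u v)%:E)%E.
Proof. by move=> Hu Hv; case: (leP u v). Qed.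

Lemma lq_price_ge0 q : 0 <= lq_price q.
Proof. exact: le_trans (flat_price_ge0 R) (flat_le_lq_price q). Qed.

Section FixedRadius.
Variables (q t : R).
Hypotheses (q0 : 0 < q) (q1 : q <= 1) (t0 : 0 < t).
Local Notation mu := (m_upper n M sigma q t).
Local Notation ms := (m_lower n M sigma q t).

(** The [m_lower] columns are shared evenly: half for the large coefficients,
half for the sample.  From [m_lower] >= 2 on, each half is at least a third. *)
Lemma risk_rate_le th : (mu < minn M n)%N -> (1 < ms)%N -> Defs.normq q th <= t ->
  (risk <= (normn2 (th *m X^T - f)
     + lq_price q * lq_rate n sigma q t (ln (M%:R / snr n sigma q t)))%:E)%E.
Proof.
move=> lt ms1 tht.
pose a := ms./2; pose b := (ms - a)%N.
have msE : ms = (odd ms + a + a)%N by rewrite -addnA addnn odd_double_half.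
have bE : b = (odd ms + a)%N by rewrite /b {1}msE addnK.
have a0 : (0 < a)%N by rewrite half_gt0.
have b0 : (0 < b)%N by rewrite bE (leq_trans a0)// leq_addl.
have ab : (a + b)%N = ms by rewrite bE addnC -msE.
have msa : (ms <= 3 * a)%N.
  rewrite [X in (X <= _)%N]msE mulSn mul2n -addnn -addnA leq_add2r.
  exact: leq_trans (leq_b1 _) a0.
have msb : (ms <= 3 * b)%N.
  rewrite [X in (X <= _)%N]msE bE mulSn mul2n -addnn leq_add2l.
  exact: leq_trans (leq_addl _ _) (leq_addr _ _).
pose v := t * a%:R `^ (- q^-1).
have v0 : 0 < v by rewrite mulr_gt0 ?powR_gt0 ?ltr0n.
pose H := [set j : 'I_M | (v < `|th 0 j|)%R]%SET.
have Ha : (#|H| <= a)%N by exact: card_gt_threshold q0 t0 a0 tht.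
have tail : \sum_(j | j \notin H) `|th 0 j| <= v `^ (1 - q) * t `^ q.
  by apply: sum_small_le => // j; rewrite inE -leNgt.
have tail0 : 0 <= \sum_(j | j \notin H) `|th 0 j| by apply: sumr_ge0.
have := maurey_rate n0 M0 s0 t0 q0 q1 lt ms1 a0 b0 msa msb.
set F := (1 + ln (M%:R / mu%:R)) `^ (1 - q / 2) => mr.
have He : (\sum_(j | j \notin H) `|th 0 j|) ^+ 2 / b%:R <=
    3%:R `^ (2 / q - 1) * (sigma ^+ 2 / n%:R * (snr n sigma q t * F)).
  apply: le_trans mr; rewrite ler_pM2r ?invr_gt0 ?ltr0n// ler_sqr ?nnegrE//.
  exact: le_trans tail0 tail.
have kk : (#|H| + b <= ms <= minn (M - 1) n)%N.
  rewrite -{1}ab leq_add2r Ha lt_minn_pred//.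
  exact: leq_ltn_trans (m_lower_le_upper n0 M0 s0 t0 q0) lt.
apply: (le_trans (risk_maurey_le b0 kk He)); rewrite lee_fin lerD2l.
have pr := sparsity_price_m_lower n0 M0 s0 t0 q0 q1 lt ms1; rewrite -/F in pr.
rewrite lq_rateE//; last exact: ln_snr_ge0.
set F' := (1 + ln (M%:R / snr n sigma q t)) `^ (1 - q / 2).
have FF' : F <= F' by exact: rate_factor_le.
have S0 := snr_gt0 q n0 s0 t0.
have c0 : 0 < sigma ^+ 2 / n%:R by rewrite divr_gt0 ?exprn_gt0 ?ltr0n.
have G0 : 0 <= sigma ^+ 2 / n%:R * (snr n sigma q t * F).
  by rewrite mulr_ge0 ?(ltW c0)// mulr_ge0 ?(ltW S0) ?powR_ge0.
have GG' : sigma ^+ 2 / n%:R * (snr n sigma q t * F) <=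
    sigma ^+ 2 / n%:R * (snr n sigma q t * F').
  by rewrite ler_pM2l// ler_pM2l.
have pr' : sigma ^+ 2 * sparsity_price M ms / n%:R <=
    8 * (sigma ^+ 2 / n%:R * (snr n sigma q t * F)).
  by rewrite [leLHS]mulrAC [leRHS]mulrCA ler_pM2l.
have fp := flat_price_ge0 R; have p3 := powR_ge0 (3%:R : R) (2 / q - 1).
rewrite /lq_price; move: GG' G0 pr'.
set G := _ * (_ * F); set G' := _ * (_ * F'); nra.
Qed.

(** No coefficient exceeds t, so at level t nothing is kept and a single column is
drawn. *)
Lemma risk_one_sample_le th : (mu < minn M n)%N -> ms = 1%N -> Defs.normq q th <= t ->
  (risk <= (normn2 (th *m X^T - f)
     + lq_price q * (sigma ^+ 2 * (1 + ln M%:R) / n%:R))%:E)%E.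
Proof.
move=> lt ms1 tht.
have tail : \sum_(j | j \notin (finset.set0 : {set 'I_M})) `|th 0 j| <= t.
  have -> : t = t `^ (1 - q) * t `^ q.
    by rewrite -powRD ?subrK ?powRr1 ?(ltW t0)// gt_eqF ?implybT.
  by apply: sum_small_le => // j _; exact: coord_le tht.
have tail0 : 0 <= \sum_(j | j \notin (finset.set0 : {set 'I_M})) `|th 0 j|.
  by apply: sumr_ge0.
have He : (\sum_(j | j \notin (finset.set0 : {set 'I_M})) `|th 0 j|) ^+ 2 / 1%:R <= t ^+ 2.
  by rewrite divr1 ler_sqr ?nnegrE// ltW.
have kk : (#|(finset.set0 : {set 'I_M})| + 1 <= 1 <= minn (M - 1) n)%N.
  by rewrite cards0 (leq_trans (m_upper_gt0 q n0 M0 s0 t0))// lt_minn_pred.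
apply: (le_trans (risk_maurey_le (ltn0Sn 0) kk He)); rewrite lee_fin lerD2l.
have sr := one_term_rate n0 M0 s0 t0 q0 lt ms1.
have -> : sparsity_price M 1 = 1 + ln M%:R :> R by rewrite /sparsity_price mul1r divr1.
have fp := flat_price_ge0 R; have p3 := powR_ge0 (3%:R : R) (2 / q - 1).
move: sr; rewrite mulrAC /lq_price => sr.
have := le_trans (sqr_ge0 t) sr; move: sr.
set G := _ * (1 + _); nra.
Qed.

(** Here the rank is at most min(M, n) <= 2 snr, and the power of the logarithmic
factor is at least one. *)
Lemma risk_saturated_le th : mu = minn M n -> (1 < ms)%N ->
  (risk <= (normn2 (th *m X^T - f)
     + lq_price q * lq_rate n sigma q t (Num.max 0 (ln (M%:R / snr n sigma q t))))%:E)%E.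
Proof.
move=> e ms1; apply: (le_trans (risk_full_le f0 n0 s0 nrm th r1)).
rewrite lee_fin lerD2l lq_rateE//; last by rewrite le_max lexx.
set F := _ `^ (1 - q / 2).
have F1 : 1 <= F.
  rewrite -[leLHS](powRr0 (1 + Num.max 0 (ln (M%:R / snr n sigma q t)))) /F ler_powR//.
    by rewrite lerDl le_max lexx.
  by have := q1; lra.
have S0 := snr_gt0 q n0 s0 t0; have sat := snr_saturated n0 s0 t0 e.
have m2 : (2 : R) <= (minn M n)%:R.
  by rewrite ler_nat -e; exact: leq_trans ms1 (m_lower_le_upper n0 M0 s0 t0 q0).
have rm : (model_rank X FullModel)%:R <= (minn M n)%:R :> R by rewrite ler_nat rank_le_minn.
have SF : snr n sigma q t <= snr n sigma q t * F by rewrite ler_peMr// ltW.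
have rS : (model_rank X FullModel)%:R <= 2 * (snr n sigma q t * F) by lra.
have fp := flat_price_ge0 R; have p3 := powR_ge0 (3%:R : R) (2 / q - 1).
have c0 : 0 < sigma ^+ 2 / n%:R by rewrite divr_gt0 ?exprn_gt0 ?ltr0n.
rewrite mulrAC; have := ler_wpM2l (ltW c0) rS; rewrite mulrCA.
have : 0 <= sigma ^+ 2 / n%:R * (snr n sigma q t * F).
  by rewrite mulr_ge0 ?(ltW c0)// (le_trans (ltW S0)).
rewrite /lq_price; set G := _ * (_ * F); set K := _ * _%:R; nra.
Qed.

End FixedRadius.

(** Beyond min(M - 1, n) there is no submodel of size k, but then k is at least
the rank and the full model is cheaper. *)
Lemma risk_sparse_or_full th k : (1 <= k)%N -> (k <= M)%N -> (norm0 th <= k)%N ->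
  (risk <= (normn2 (th *m X^T - f)
     + (flat_price R + 13%:R) * (sigma ^+ 2 * k%:R * (1 + ln (M%:R / k%:R)) / n%:R))%:E)%E.
Proof.
move=> k1 kM thk.
have sp : sigma ^+ 2 * k%:R * (1 + ln (M%:R / k%:R)) / n%:R =
    sigma ^+ 2 * sparsity_price M k / n%:R.
  by rewrite /sparsity_price mulrA.
rewrite sp; have fp := flat_price_ge0 R.
have p0 : 0 <= sparsity_price M k :> R by apply: le_trans (sparsity_price_ge_size k1 kM).
have sp0 : 0 <= sigma ^+ 2 * sparsity_price M k / n%:R.
  by rewrite divr_ge0// mulr_ge0 ?sqr_ge0.
have [kmin|kmin] := leqP k (minn (M - 1) n).
  apply: (le_trans (risk_sparse_le X f0 n0 s0 nrm (k := k) _ thk)); first by rewrite k1.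
  by rewrite lee_fin lerD2l ler_wpM2r// lerDr.
apply: (le_trans (risk_full_le f0 n0 s0 nrm th r1)).
rewrite lee_fin lerD2l [leRHS]mulrDl.
apply: (@le_trans _ _ (flat_price R * (sigma ^+ 2 * sparsity_price M k / n%:R))); last first.
  by rewrite lerDl mulr_ge0.
rewrite ler_wpM2l// ler_pM2r ?invr_gt0 ?ltr0n// ler_wpM2l ?sqr_ge0//.
apply: le_trans (sparsity_price_ge_size k1 kM); rewrite ler_nat.
apply: leq_trans rank_le_minn _; move: kmin; rewrite gtn_min geq_min => /orP[|].
  by rewrite subn1 prednK// => ->.
by move=> /ltnW ->; rewrite orbT.
Qed.

Lemma sparse_price_le_lq_price q : flat_price R + 13%:R <= lq_price q.
Proof.
have := flat_price_ge0 R; have := powR_ge0 (3%:R : R) (2 / q - 1).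
rewrite /lq_price; lra.
Qed.

Lemma m_lower_saturated q t : m_upper n M sigma q t = minn M n ->
  m_lower n M sigma q t = minn M n.
Proof. by move=> e; rewrite /m_lower e eqxx. Qed.

(** Besides one drawn column there is the saturated case min(M, n) = 1, in which
the rank is 1. *)
Lemma risk_one_term_le (q t : R) th : 0 < q -> q <= 1 -> 0 < t -> Defs.normq q th <= t ->
  m_lower n M sigma q t = 1%N ->
  (risk <= (normn2 (th *m X^T - f)
     + lq_price q * Num.min (sigma ^+ 2 * (1 + ln M%:R))
                       (sigma ^+ 2 * (model_rank X FullModel)%:R) / n%:R)%:E)%E.
Proof.
move=> q0 q1 t0 tht ms1.
have fullb := risk_full_lq th q.
have minE (a b : R) : Num.min a b / n%:R = Num.min (a / n%:R) (b / n%:R).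
  by rewrite minr_pMl// invr_ge0.
rewrite -mulrA minE; apply: risk_le_min => //.
have [mulow|muminn] := ltnP (m_upper n M sigma q t) (minn M n).
  exact: (risk_one_sample_le q0 q1 t0 mulow ms1 tht).
have e : m_upper n M sigma q t = minn M n by apply/eqP; rewrite eqn_leq m_upper_le.
apply: le_trans fullb _; rewrite lee_fin lerD2l ler_wpM2l ?lq_price_ge0//.
rewrite ler_pM2r ?invr_gt0 ?ltr0n// ler_wpM2l ?sqr_ge0//.
apply: (@le_trans _ _ 1%:R); last by rewrite lerDl ln_ge0// ler1n.
by rewrite ler_nat -ms1 (m_lower_saturated e) rank_le_minn.
Qed.

End LqRisk.

Lemma Fq_zero (R : realType) (M : nat) (q t : R) : 0 < q -> 0 < t ->
  Fq q t (flin (0 : 'rV[R]_M)).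
Proof.
move=> q0 t0; exists 0 => //=; rewrite /Defs.normq big1 ?powR0 ?invr_eq0 ?gt_eqF// ?ltW//.
by move=> j _; rewrite mxE normr0 powR0// gt_eqF.
Qed.

Lemma F0_zero (R : realType) (M k : nat) : F0 k (flin (0 : 'rV[R]_M)).
Proof.
by exists 0 => //=; rewrite /norm0 eq_card0// => j; rewrite !inE mxE eqxx.
Qed.

Theorem theorem9 (R : realType) :
  exists (B1 B3 : R -> R) (Bt1 B2 Bt3 B4 : R),
  forall (n M : nat) (sigma : R) (X : 'M[R]_(n, M)) (f0 : 'rV[R]_M -> R)
         (d : measure_display) (T : measurableType d) (P : probability T R)
         (eps : 'I_n -> {RV P >-> R}),
    (1 <= n)%N -> (1 <= M)%N -> 0 < sigma ->
    normalized_design X ->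
    (1 <= model_rank X FullModel)%N ->
    iid_normal eps sigma ->
    let risk : \bar R := risk_MLS eps sigma X f0 in
    let full : R := sigma ^+ 2 * (model_rank X FullModel)%:R / n%:R in
    let sparse (k : nat) : R :=
      sigma ^+ 2 * k%:R * (1 + ln (M%:R / k%:R)) / n%:R in
    let null_error : R :=
      normn2 (model_fit X NullModel (at_design X f0) - at_design X f0) in
    (* (i) *)
    (forall q t : R, 0 < q -> q <= 1 -> 0 < t ->
      let ms := m_lower n M sigma q t in
      [/\ ms = minn M n ->
            (risk <= (dn2 X f0 (@Fq R M q t) + B1 q * full)%:E)%E,
          (1 < ms < minn M n)%N ->
            (risk <= (dn2 X f0 (@Fq R M q t)
              + B1 q * Num.min
                  (lq_rate n sigma q t (ln (M%:R / snr n sigma q t)))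
                  full)%:E)%E
        & ms = 1%N ->
            (risk <= (Num.min
              (dn2 X f0 (@Fq R M q t)
               + B1 q * Num.min
                   (sigma ^+ 2 * (1 + ln M%:R))
                   (sigma ^+ 2 * (model_rank X FullModel)%:R) / n%:R)
              (null_error + Bt1 * sigma ^+ 2 / n%:R))%:E)%E])
    (* (ii) *)
    /\ (forall k : nat, (1 <= k)%N -> (k <= M)%N ->
      (risk <= (dn2 X f0 (@F0 R M k)
                + B2 * Num.min (sparse k) full)%:E)%E)
    (* (iii) *)
    /\ (forall (q t : R) (k : nat), 0 < q -> q <= 1 -> 0 < t ->
      (1 <= k)%N -> (k <= M)%N ->
      let ms := m_lower n M sigma q t in
      let F := @Fq R M q t `&` @F0 R M k in
      [/\ (k < ms)%N ->
            (risk <= (dn2 X f0 F + B3 q * Num.min (sparse k) full)%:E)%E,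
          (* the logarithm is truncated at 0: it can only be negative when   *)
          (* ms = minn M n, and then this bound is of the order of full      *)
          (1 < ms <= k)%N ->
            (risk <= (dn2 X f0 F
              + B3 q * Num.min
                  (lq_rate n sigma q t
                     (Num.max 0 (ln (M%:R / snr n sigma q t))))
                  full)%:E)%E
        & ms = 1%N ->
            (risk <= (Num.min
              (dn2 X f0 F
               + B3 q * Num.min
                   (sigma ^+ 2 * (1 + ln M%:R))
                   (sigma ^+ 2 * (model_rank X FullModel)%:R) / n%:R)
              (null_error + Bt3 * sigma ^+ 2 / n%:R))%:E)%E])
    (* (iv) *)
    /\ (risk <= (B4 * sigma ^+ 2)%:E)%E.
Proof.
exists (@lq_price R), (@lq_price R), (flat_price R), (flat_price R + 13%:R).
exists (flat_price R), (flat_price R).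
move=> n M sigma X f0 d T P eps n0 M0 s0 nX r1 nrm risk full sparse null_error.
have le_inf F c : F !=set0 ->
    (forall g, F g -> exists2 th : 'rV[R]_M, at_design X g = th *m X^T &
       (risk <= (normn2 (th *m X^T - at_design X f0) + c)%:E)%E) ->
    (risk <= (dn2 X f0 F + c)%:E)%E.
  move=> F0 H; apply: (risk_le_dn2 n0 s0 nrm F0) => g Fg.
  by have [th -> ] := H g Fg.
have null_le : (risk <= (null_error + flat_price R * sigma ^+ 2 / n%:R)%:E)%E.
  exact: risk_null_le.
have min_le (u v : R) : (risk <= u%:E)%E -> (risk <= v%:E)%E -> (risk <= (Num.min u v)%:E)%E.
  by case: (leP u v).
split; [move=> q t q0 q1 t0 ms|split; [move=> k k1 kM|split; [move=> q t k q0 q1 t0 k1 kM ms F|]]].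
- have FF : @Fq R M q t !=set0 by exists (flin 0); exact: Fq_zero.
  split => Hms.
  + apply: le_inf => // _ [th tht <-]; exists th; first exact: at_design_flin.
    exact: risk_full_lq.
  + apply: le_inf => // _ [th tht <-]; exists th; first exact: at_design_flin.
    apply: risk_le_min; last exact: risk_full_lq.
    have /andP[ms1 msm] := Hms.
    apply: risk_rate_le => //.
    rewrite ltn_neqAle m_upper_le andbT; apply/eqP => e.
    by move: msm; rewrite /ms (m_lower_saturated e) ltnn.
  + apply: min_le => //.
    apply: le_inf => // _ [th tht <-]; exists th; first exact: at_design_flin.
    exact: (risk_one_term_le _ _ _ _ _ _ _ q0 q1 t0 tht Hms).
- apply: le_inf; first by exists (flin 0); exact: F0_zero.
  move=> _ [th thk <-]; exists th; first exact: at_design_flin.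
  apply: risk_le_min; first exact: risk_sparse_or_full.
  apply: (le_trans (risk_full_le f0 n0 s0 nrm th r1)).
  by rewrite lee_fin lerD2l ler_wpM2r ?full_ge0// lerDl.
- have FF : F !=set0 by exists (flin 0); split; [exact: Fq_zero|exact: F0_zero].
  split => Hms.
  + apply: le_inf => // _ [_ [th thk <-]]; exists th; first exact: at_design_flin.
    apply: risk_le_min; last exact: risk_full_lq.
    apply: (le_trans (risk_sparse_or_full f0 n0 M0 s0 nrm r1 k1 kM thk)).
    rewrite lee_fin lerD2l ler_wpM2r ?sparse_price_le_lq_price//.
    apply: divr_ge0 => //; apply: mulr_ge0; first by apply: mulr_ge0 => //; exact: sqr_ge0.
    by rewrite addr_ge0// ln_ge0// ler_pdivlMr ?ltr0n// mul1r ler_nat.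
  + apply: le_inf => // _ [[th tht <-] _]; exists th; first exact: at_design_flin.
    apply: risk_le_min; last exact: risk_full_lq.
    have /andP[ms1 msk] := Hms.
    have [mulow|muminn] := ltnP (m_upper n M sigma q t) (minn M n).
      have -> : Num.max 0 (ln (M%:R / snr n sigma q t)) = ln (M%:R / snr n sigma q t).
        by apply/max_idPr; exact: ln_snr_ge0.
      exact: risk_rate_le.
    apply: risk_saturated_le => //.
    by apply/eqP; rewrite eqn_leq m_upper_le.
  + apply: min_le => //.
    apply: le_inf => // _ [[th tht <-] _]; exists th; first exact: at_design_flin.
    exact: (risk_one_term_le _ _ _ _ _ _ _ q0 q1 t0 tht Hms).
- exact: risk_proj_le.
Qed.
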